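(* Let $f_0$ be a monotone decreasing (i.e. nonincreasing) probability density on $[-1,\infty)$ that is continuous at $0$. For a monotone decreasing density $f$ on $[-1,\infty)$ let $\mathbb{P}_f$ be the law under which $X_1,\dots,X_n$ are i.i.d. with density $f$, and let $\hat f$ denote the Grenander estimator (defined in the context). Choose two significance levels $\alpha\in(0,1)$ and $\beta\in(0,1/2)$. There exists $\eta>0$ such that for all $n$ large enough we can find a monotone decreasing density $f_1$ on $[-1,\infty)$ (close to $f_0$), and we can find a rate $\gamma_n$, with $$\limsup_{n\to\infty}\ \max_{i=0,1}\ \mathbb{P}_{f_i}\big(|\hat f(0)-f_i(0)|\ge\gamma_n\big)\le\alpha$$ and $$\liminf_{n\to\infty}\ \inf_{\hat\theta}\ \max_{i=0,1}\ \mathbb{P}_{f_i}\big(|\hat\theta(X_1,\dots,X_n)-f_i(0)|\ge\eta\cdot\gamma_n\big)>\beta,$$ where $\hat\theta(X_1,\dots,X_n)$ is any estimator of $f(0)$ based on the data $(X_1,\dots,X_n)$.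
   Context: Grenander estimator: let $\mathbb{F}_n$ be the empirical distribution function of the sample $X_1,\dots,X_n$, let $\hat F(t)=\inf\{\phi(t):\phi\text{ affine and }\phi(s)\ge\mathbb{F}_n(s)\text{ for all }s\ge-1\}$ be its smallest concave majorant, and let $\hat f(t)=\lim_{h\downarrow0}(\hat F(t+h)-\hat F(t))/h$. The density $f_1$ may depend on $n$; $\eta$ does not. The phrase ''close to $f_0$'' is an informal remark, not given a quantitative meaning in the statement. *)

(* Defs.v *)
From HB Require Import structures.
From mathcomp Require Import all_boot all_order all_algebra.
From mathcomp Require Import all_classical all_reals all_analysis.
From mathcomp Require Import measurable_realfun.

Set Implicit Arguments.
Unset Strict Implicit.
Unset Printing Implicit Defensive.

Import Order.TTheory GRing.Theory Num.Theory.
Import numFieldNormedType.Exports.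

Local Open Scope classical_set_scope.
Local Open Scope ring_scope.

(* The values of [density] outside [-1, +oo[ are irrelevant: nothing below
   looks at them. *)
Record decreasing_density (R : realType) := DecreasingDensity {
  density :> R -> R;
  density_ge0 : forall x : R, -1 <= x -> 0 <= density x;
  density_decreasing : forall x y : R, -1 <= x -> x <= y -> density y <= density x;
  density_integral :
    (\int[lebesgue_measure]_(x in `[(-1)%R, +oo[) (density x)%:E = 1)%E }.

Section density_law.
Context {R : realType}.
Local Notation mu := (@lebesgue_measure R).
Variable f : decreasing_density R.

Definition density_law (A : set R) : \bar R :=
  (\int[mu]_(x in A `&` `[(-1)%R, +oo[) (f x)%:E)%E.

Lemma measurable_density : measurable_fun (`[-1, +oo[ : set R) f.
Proof.
apply: (eq_measurable_fun (fun x : R => f (Num.max (-1) x))).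
  by move=> x; rewrite inE/= in_itv/= andbT => /max_idPr ->.
apply: nonincreasing_measurable => // x y xy.
apply: density_decreasing; first by rewrite le_max lexx.
by rewrite ge_max le_max lexx/= le_max xy orbT.
Qed.

Let density_law0 : density_law set0 = 0%E.
Proof. by rewrite /density_law set0I integral_set0. Qed.

Let density_law_ge0 A : (0 <= density_law A)%E.
Proof.
apply: integral_ge0 => x [_]/=; rewrite in_itv/= andbT => x1.
by rewrite lee_fin density_ge0.
Qed.

Let density_law_sigma_additive : semi_sigma_additive density_law.
Proof.
move=> /= F mF tF mUF; rewrite /density_law; apply: cvg_toP.
  apply: ereal_nondecreasing_is_cvgn => m n mn.
  by apply: lee_sum_nneg_natr => // k _ _; exact: density_law_ge0.
rewrite setI_bigcupl ge0_integral_bigcup//=.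
- by move=> k; apply: measurableI (mF k) _; exact: (measurable_itv (Interval _ _)).
- apply/measurable_EFinP; apply: measurable_funS measurable_density => //.
  by apply: bigcup_sub => k _; exact: subIsetr.
- move=> x [k _ [_]]/=; rewrite in_itv/= andbT => x1.
  by rewrite lee_fin density_ge0.
- by under eq_fun do rewrite setIC; exact: trivIset_setIl.
Qed.

HB.instance Definition _ := isMeasure.Build _ _ _
  density_law density_law0 density_law_ge0 density_law_sigma_additive.

Let density_law_setT : density_law [set: R] = 1%E.
Proof. by rewrite /density_law setTI density_integral. Qed.

HB.instance Definition _ :=
  @Measure_isProbability.Build _ _ R density_law density_law_setT.

End density_law.

Section iid_law.
Context d (T : measurableType d) {R : realType}.

Definition tuple_cons n (x : T * n.-tuple T) : n.+1.-tuple T :=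
  [tuple of x.1 :: x.2].

Lemma measurable_tuple_cons n : measurable_fun setT (@tuple_cons n).
Proof. exact: measurable_cons. Qed.

HB.instance Definition _ n :=
  isMeasurableFun.Build _ _ _ _ (@tuple_cons n) (@measurable_tuple_cons n).

(* The n-fold product measure of P: the law of an i.i.d. sample of size n. *)
Fixpoint iid_law (P : probability T R) n : probability (n.-tuple T) R :=
  match n with
  | 0 => \d_([tuple] : 0.-tuple T)
  | m.+1 => distribution (P \x iid_law P m)%E (@tuple_cons m)
  end.

Lemma iid_law_rectangle (P : probability T R) n (A : 'I_n -> set T) :
  (forall i, measurable (A i)) ->
  iid_law P n [set x | forall i, A i (tnth x i)] = (\prod_(i < n) P (A i))%E.
Proof.
elim: n A => [|n IH] A mA.
  rewrite big_ord0 /= diracE mem_set//; by case.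
have mB : measurable [set x : n.-tuple T | forall i, A (lift ord0 i) (tnth x i)].
  rewrite [X in measurable X](_ : _ =
    \bigcap_(i : 'I_n) ((fun x : n.-tuple T => tnth x i) @^-1` A (lift ord0 i))).
    apply: fin_bigcap_measurable => // i _.
    by rewrite -[X in measurable X]setTI; exact: measurable_tnth.
  by apply/seteqP; split => x /= xA i => [_|]; apply: xA.
rewrite big_ord_recl -IH// -product_measure1E//=.
rewrite /distribution /pushforward/=; congr ((_ \x _)%E _).
apply/seteqP; split => -[x t] /=.
  move=> h; split; first exact: (h ord0).
  by move=> i; have := h (lift ord0 i); rewrite tnthS.
move=> [xA tA] i; case: (unliftP ord0 i) => [j|] ->; last by [].
by rewrite tnthS; exact: tA.
Qed.

End iid_law.

Section grenander.
Context {R : realType}.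

Definition empirical_cdf n (X : n.-tuple R) (s : R) : R :=
  (\sum_(i < n) (tnth X i <= s)%R%:R) / n%:R.

Definition affine (phi : R -> R) : Prop :=
  exists a b : R, forall t, phi t = a * t + b.

Definition concave_majorant n (X : n.-tuple R) (t : R) : R :=
  inf [set phi t | phi in [set phi : R -> R |
    affine phi /\ forall s, -1 <= s -> empirical_cdf X s <= phi s]].

Definition grenander n (X : n.-tuple R) (t : R) : R :=
  lim ((concave_majorant X (t + h) - concave_majorant X t) / h @[h --> 0^'+]).

End grenander.

Section tail_prob.
Context {R : realType}.

(* [tail_prob f theta c] is P_f(|theta(X_1, ..., X_n) - f(0)| >= c). *)
Definition tail_prob n (f : decreasing_density R) (theta : n.-tuple R -> R)
    (c : R) : \bar R :=
  iid_law (density_law f) n [set X | c <= `|theta X - f 0|].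

End tail_prob.

(* Main.v *)
Require Import Defs.
From HB Require Import structures.
From mathcomp Require Import all_boot all_order all_algebra.
From mathcomp Require Import all_classical all_reals all_analysis.
From mathcomp Require Import measurable_realfun.
From mathcomp Require Import ring lra.

Import Order.TTheory GRing.Theory Num.Theory.
Import numFieldNormedType.Exports.

Set Implicit Arguments.
Unset Strict Implicit.
Unset Printing Implicit Defensive.

Local Open Scope classical_set_scope.
Local Open Scope ring_scope.

(** The proof is a two-point argument in which the rate is read off from the
    behaviour of f0 on a shrinking window around 0.

    Let a = f0(0) > 0.  For each n take the largest dyadic h <= 1 for which
    f0(-h) - f0(h) <= r, where n h r^2 = 1 ([balanced_window_exists]).  On this
    window the bias of a local histogram estimator is at most r, and r is also
    the order of its standard deviation; the claim is that the risk of the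
    Grenander estimator at 0 is of order r, and that no estimator does better
    on f0 and a well chosen neighbour f1.

    Upper bound.  The slope at 0 of the least concave majorant is at most m as
    soon as F_n(t) - F_n(-h) <= m (t + h) for all t >= 0, and at least m as soon
    as F_n(h) - F_n(s) >= m (h - s) for all s in [-1, 0] ([grenander_le],
    [grenander_ge]).  So the number of observations in a growing family of
    intervals has to be compared with its mean, uniformly over the family.  The
    relative frequency N(A)/(n P(A)) is a martingale when A shrinks along a
    chain, hence Kolmogorov's maximal inequality controls all the intervals at
    the cost of the smallest one, whose probability is of order a h
    ([chain_deviation_le]): a relative error x is exceeded with probability at
    most 1/(n a h x^2).  With x of order r this is a small constant, without
    any logarithmic loss ([grenander_concentration]).

    Lower bound.  If h < 1, the window of size 2h violates the balance, so f0
    exceeds a by a multiple of r at -2h or falls below a by a multiple of r at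
    2h.  Then the value at 0 can be raised to a + e, or lowered to a - e, with e
    a small multiple of r, by changing f0 by at most e, on one side of 0 only and
    only within distance 2h, and renormalizing.  If h = 1 the value can be
    raised in the same way on the whole of [-1, 0].  The chi-square distance
    between f0 and the new density f1 is of order e^2 h / a, that is, of order
    1/n with a constant as small as desired.  Therefore the laws of the two
    samples differ by at most eps in total variation, which is proved by
    tensorizing a second moment bound ([second_moment_dominated_iid],
    [second_moment_total_variation]).  Renormalization does not destroy the
    separation of the values at 0 because a < 1, and this is where continuity
    at 0 enters ([density_at0_lt1]).

    Closeness in total variation serves twice: it makes the two values at 0
    impossible to tell apart ([le_cam_two_points]), and it transfers the upper
    bound from f0 to f1 ([grenander_risk]), so that the Grenander estimator is
    analysed under f0 only.

    If a = 0, no observation is positive under f0 and the Grenander estimator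
    vanishes at 0 almost surely; raising f0 to c/n on [-1, 0] gives the neighbour,
    and the rate is 1/n ([matched_rate_eq0]). *)

(** * A maximal inequality for relative frequencies in a finite sample space *)

Section finite_sample.
Context {R : realFieldType} {K : finType} (w : K -> R) {n : nat}.
Implicit Types (c : {ffun 'I_n -> K}) (A B D : pred K).
Implicit Types g : {ffun 'I_n -> K} -> R.

Definition mass A : R := \sum_k w k * (A k)%:R.

(** The expectation of the statistic [g] of an i.i.d. sample with weights [w]. *)
Definition sample_mean g : R := \sum_(c : {ffun 'I_n -> K}) (\prod_i w (c i)) * g c.

Definition replace c (i : 'I_n) (k : K) : {ffun 'I_n -> K} :=
  [ffun j => if j == i then k else c j].

(* Exchanging the i-th observation with an extra, independent one. *)
Let swap (i : 'I_n) (p : {ffun 'I_n -> K} * K) := (replace p.1 i p.2, p.1 i).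

Let swapK i : involutive (swap i).
Proof.
move=> [c k]; rewrite /swap /=; congr pair; last by rewrite ffunE eqxx.
by apply/ffunP => j; rewrite !ffunE; case: eqVneq => // ->.
Qed.

Let weight_swap c i k :
  (\prod_j w (replace c i k j)) * w (c i) = (\prod_j w (c j)) * w k.
Proof.
rewrite (bigD1 i)//= [in RHS](bigD1 i)//= ffunE eqxx.
rewrite (eq_bigr (fun j => w (c j))) => [|j /negbTE ji]; last by rewrite ffunE ji.
by rewrite [LHS]mulrAC [RHS]mulrAC (mulrC (w k)).
Qed.

(** Conditionally on the i-th observation lying in [D], its exact position has no
    influence on [g].  The proof adds an independent observation and
    exchanges it with the i-th one, an involution that preserves the weights. *)
Lemma sample_mean_swap (i : 'I_n) A B D g :
  {subset A <= D} -> {subset B <= D} ->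
  (forall c k, D (c i) -> D k -> g (replace c i k) = g c) ->
  sample_mean (fun c => (A (c i))%:R * g c) * mass B =
  sample_mean (fun c => (B (c i))%:R * g c) * mass A.
Proof.
move=> AD BD gD; rewrite /sample_mean /mass !mulr_suml.
under eq_bigr do rewrite mulr_sumr.
under [RHS]eq_bigr do rewrite mulr_sumr.
rewrite !pair_big/= (reindex_inj (inv_inj (swapK i)))/=.
apply: eq_bigr => -[c k] _ /=; rewrite ffunE eqxx.
have [Ak|] := boolP (A k); last by rewrite !(mul0r, mulr0).
have [Bc|] := boolP (B (c i)); last by rewrite !(mul0r, mulr0).
rewrite gD ?mulr1 ?mul1r; [|exact: BD|exact: AD].
by rewrite mulrAC weight_swap; ring.
Qed.

Lemma sample_meanD g g' :
  sample_mean (fun c => g c + g' c) = sample_mean g + sample_mean g'.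
Proof. by rewrite -big_split; apply: eq_bigr => c _; rewrite mulrDr. Qed.

Lemma sample_meanZ a g : sample_mean (fun c => a * g c) = a * sample_mean g.
Proof. by rewrite mulr_sumr; apply: eq_bigr => c _; rewrite mulrCA. Qed.

Lemma sample_mean_sum (I : finType) (g : I -> {ffun 'I_n -> K} -> R) :
  sample_mean (fun c => \sum_i g i c) = \sum_i sample_mean (g i).
Proof.
by rewrite exchange_big; apply: eq_bigr => c _; rewrite mulr_sumr.
Qed.

Lemma eq_sample_mean g g' : g =1 g' -> sample_mean g = sample_mean g'.
Proof. by move=> gg'; apply: eq_bigr => c _; rewrite gg'. Qed.

Context (w_ge0 : forall k, 0 <= w k) (w_sum : \sum_k w k = 1).

Lemma le_sample_mean g g' : (forall c, g c <= g' c) ->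
  sample_mean g <= sample_mean g'.
Proof.
by move=> gg'; apply: ler_sum => c _; rewrite ler_wpM2l// prodr_ge0.
Qed.

Lemma sample_mean1 : sample_mean (fun=> 1) = 1.
Proof.
rewrite /sample_mean; under eq_bigr do rewrite mulr1.
rewrite -(bigA_distr_bigA (fun _ k => w k)).
by rewrite big1// => i _; rewrite w_sum.
Qed.

Lemma mass_predT : mass predT = 1.
Proof. by rewrite -[RHS]w_sum; apply: eq_bigr => k _; rewrite mulr1. Qed.

Lemma sample_mean_indic i A g :
  (forall c k, g (replace c i k) = g c) ->
  sample_mean (fun c => (A (c i))%:R * g c) = mass A * sample_mean g.
Proof.
move=> gi; have := @sample_mean_swap i A predT predT g (fun _ _ => isT)
  (fun _ _ => isT) (fun c k _ _ => gi c k).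
rewrite mass_predT mulr1 => ->.
by rewrite mulrC; congr (_ * _); apply: eq_sample_mean => c; rewrite mul1r.
Qed.

Lemma sample_mean_indic1 i A : sample_mean (fun c => (A (c i))%:R) = mass A.
Proof.
have := @sample_mean_indic i A (fun=> 1) (fun _ _ => erefl).
by rewrite sample_mean1 mulr1 => <-; apply: eq_sample_mean => c; rewrite mulr1.
Qed.

Definition occ A c : R := \sum_i (A (c i))%:R.

Lemma sample_mean_occ A : sample_mean (occ A) = n%:R * mass A.
Proof.
rewrite sample_mean_sum (eq_bigr (fun=> mass A)).
  by rewrite sumr_const card_ord mulr_natl.
by move=> i _; exact: sample_mean_indic1.
Qed.

(** In the expansion of the square, a product of two distinct indicators has mean
    [mass A ^+ 2], and a repeated one has mean [mass A]. *)
Lemma sample_mean_occ2 A :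
  sample_mean (fun c => occ A c ^+ 2) <= n%:R * mass A + (n%:R * mass A) ^+ 2.
Proof.
have -> : sample_mean (fun c => occ A c ^+ 2) =
    \sum_i \sum_j sample_mean (fun c => (A (c i))%:R * (A (c j))%:R).
  under [RHS]eq_bigr do rewrite -sample_mean_sum.
  rewrite -sample_mean_sum; apply: eq_sample_mean => c.
  by rewrite expr2 /occ mulr_suml; apply: eq_bigr => i _; rewrite mulr_sumr.
have mean1 := sample_mean_indic1 ^~ A.
apply: (@le_trans _ _ (\sum_(i < n) (mass A + \sum_(j < n) mass A ^+ 2))).
  apply: ler_sum => i _; rewrite (bigD1 i)//= lerD//.
    by rewrite -(mean1 i) le_sample_mean// => c; case: (A _); rewrite !(mulr0, mulr1).
  rewrite [leRHS](bigD1 i)//= -[leLHS]add0r lerD ?sqr_ge0//.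
  apply: ler_sum => j ji; rewrite sample_mean_indic ?mean1 -?expr2// => c k.
  by rewrite ffunE (negbTE ji).
rewrite big_split/= !sumr_const !card_ord.
by rewrite exprMn (expr2 n%:R) -mulrA !mulr_natl.
Qed.

(** The martingale property: when [B] shrinks to [A], the relative frequency has a
    centred increment, orthogonal to every statistic [g] that does not look at
    the position of the observations inside [B]. *)
Lemma occ_orthogonal A B g : {subset A <= B} -> mass A != 0 -> mass B != 0 ->
  (forall i c k, B (c i) -> B k -> g (replace c i k) = g c) ->
  sample_mean (fun c => (occ A c / mass A - occ B c / mass B) * g c) = 0.
Proof.
move=> AB A0 B0 gB.
have -> : sample_mean (fun c => (occ A c / mass A - occ B c / mass B) * g c) =
   \sum_i ((mass A)^-1 * sample_mean (fun c => (A (c i))%:R * g c) -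
           (mass B)^-1 * sample_mean (fun c => (B (c i))%:R * g c)).
  under eq_bigr do rewrite -mulNr -!sample_meanZ -sample_meanD.
  rewrite -sample_mean_sum; apply: eq_sample_mean => c.
  rewrite /occ !mulr_suml -sumrB mulr_suml.
  by apply: eq_bigr => i _; ring.
apply: big1 => i _.
have := @sample_mean_swap i A B B g AB (fun _ => id) (gB i).
move: (sample_mean _) (sample_mean _) => x y xy.
by apply/eqP; rewrite !(mulrC _^-1) subr_eq0 eqr_div// xy.
Qed.

(** Kolmogorov's inequality for the martingale of relative frequencies: [first J]
    is the event that the deviation occurs at time [J] and not before; it depends
    on the sample only through the sets up to [A J], so the later increments are
    orthogonal to it. *)
Section chain.
Context (A : nat -> pred K) (A_decr : forall j, {subset A j.+1 <= A j}).
Context (M : nat) (A_gt0 : forall j, (j <= M)%N -> 0 < mass (A j)).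
Context (x : R) (x_gt0 : 0 < x).

Let rel j c : R := occ (A j) c / mass (A j).
Let dev j c : bool := x * n%:R <= `|rel j c - n%:R|.
Let bad J c : bool := [exists j : 'I_J, dev j c].
Let first J c : bool := dev J c && ~~ bad J c.

Let sub_chain j k : (j <= k)%N -> {subset A k <= A j}.
Proof.
move=> /subnK <-; elim: (k - j)%N => [//|d IH] y; rewrite addSn => yA.
by apply: IH; apply: A_decr.
Qed.

Let badS J c : (bad J.+1 c)%:R = (bad J c)%:R + (first J c)%:R :> R.
Proof.
have -> : bad J.+1 c = bad J c || dev J c.
  apply/existsP/orP => [[j jdev]|[/existsP[j jdev]|Jdev]].
  - have [jJ|Jj] := ltnP j J.
      by left; apply/existsP; exists (Ordinal jJ).
    by right; have <- : j = J :> nat by apply/eqP; rewrite eqn_leq Jj -ltnS ltn_ord.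
  - by exists (widen_ord (leqnSn J) j).
  - by exists ord_max.
by rewrite /first; case: (bad J c); case: (dev J c); rewrite /= ?(addr0, add0r).
Qed.

Let occ_replace j J i c k : (j <= J)%N -> A J (c i) -> A J k ->
  occ (A j) (replace c i k) = occ (A j) c.
Proof.
move=> jJ ci ck; apply: eq_bigr => l _; rewrite ffunE.
by case: eqVneq => // ->; rewrite (sub_chain jJ ci : A j (c i)) (sub_chain jJ ck : A j k).
Qed.

Let first_replace J i c k : A J (c i) -> A J k ->
  (rel J (replace c i k) - n%:R) * (first J (replace c i k))%:R =
  (rel J c - n%:R) * (first J c)%:R.
Proof.
move=> ci ck; rewrite /first /dev /rel (occ_replace _ ci ck)//.
congr (_ * (_ && ~~ _)%:R); apply: eq_existsb => j.
by rewrite /dev /rel (occ_replace _ ci ck)// ltnW.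
Qed.

Let first_bound J : (J <= M)%N ->
  (x * n%:R) ^+ 2 * sample_mean (fun c => (first J c)%:R) <=
  sample_mean (fun c => (rel M c - n%:R) ^+ 2 * (first J c)%:R).
Proof.
move=> JM.
have orth := @occ_orthogonal (A M) (A J)
  (fun c => (rel J c - n%:R) * (first J c)%:R) (sub_chain JM)
  (lt0r_neq0 (A_gt0 (leqnn M))) (lt0r_neq0 (A_gt0 JM)) (@first_replace J).
rewrite -[leRHS]addr0 -[X in _ <= _ + X](mulr0 (- 2)) -[X in - 2 * X]orth.
rewrite -!sample_meanZ -sample_meanD.
apply: le_sample_mean => c; rewrite -/(rel M c) -/(rel J c).
rewrite /first; have [Jdev|] := boolP (dev J c); last by rewrite /= !mulr0 !addr0.
case: (bad J c); rewrite /= ?(mulr0, mulr1, addr0)//.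
have : (x * n%:R) ^+ 2 <= (rel J c - n%:R) ^+ 2.
  rewrite -[leRHS]real_normK ?num_real//.
  by rewrite ler_pXn2r// nnegrE// mulr_ge0// ltW.
have := sqr_ge0 (rel M c - rel J c).
by move: (rel M c) (rel J c) ((x * n%:R) ^+ 2) => u v y; nra.
Qed.

Let bad_bound J : (J <= M.+1)%N ->
  (x * n%:R) ^+ 2 * sample_mean (fun c => (bad J c)%:R) <=
  sample_mean (fun c => (rel M c - n%:R) ^+ 2 * (bad J c)%:R).
Proof.
elim: J => [|J IH] JM.
  have bad0 c : bad 0 c = false by apply/existsP => -[[]].
  rewrite -sample_meanZ le_sample_mean// => c.
  by rewrite bad0 !mulr0.
under eq_sample_mean do rewrite badS.
under [leRHS]eq_sample_mean do rewrite badS mulrDr.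
by rewrite !sample_meanD mulrDr lerD ?first_bound// IH// ltnW.
Qed.

Let variance_bound : sample_mean (fun c => (rel M c - n%:R) ^+ 2) <=
  n%:R / mass (A M).
Proof.
have p0 := A_gt0 (leqnn M); move: (sample_mean_occ2 (A M)) p0.
have := sample_mean_occ (A M); rewrite /rel; set p := mass _ => E1 E2 p0.
have -> : sample_mean (fun c => (occ (A M) c / p - n%:R) ^+ 2) =
    sample_mean (fun c => occ (A M) c ^+ 2) / p ^+ 2 - n%:R ^+ 2.
  have -> : - n%:R ^+ 2 = - (2 * n%:R / p) * sample_mean (occ (A M)) +
      n%:R ^+ 2 * sample_mean (fun=> 1).
    by rewrite E1 sample_mean1; field; exact: lt0r_neq0.
  rewrite mulrC -!sample_meanZ -!sample_meanD; apply: eq_sample_mean => c.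
  by field; exact: lt0r_neq0.
rewrite lerBlDr ler_pdivrMr ?exprn_gt0//; apply: (le_trans E2).
by rewrite le_eqVlt; apply/orP; left; apply/eqP; field; exact: lt0r_neq0.
Qed.

(** The last, smallest set of the chain carries the largest variance, and it alone
    determines the bound. *)
Lemma chain_maximal_inequality :
  n%:R * mass (A M) * x ^+ 2 * sample_mean (fun c =>
    [exists j : 'I_M.+1, x * n%:R <= `|occ (A j) c / mass (A j) - n%:R|]%:R)
  <= 1.
Proof.
have p0 := A_gt0 (leqnn M).
have : 0 <= n%:R :> R := ler0n _ _.
rewrite le_eqVlt => /orP[/eqP n0|n0]; first by rewrite -n0 !mul0r.
rewrite -[X in sample_mean X]/(fun c => (bad M.+1 c)%:R).
have : (x * n%:R) ^+ 2 * sample_mean (fun c => (bad M.+1 c)%:R) <= n%:R / mass (A M).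
  apply: (le_trans (bad_bound (leqnn _))); apply: le_trans variance_bound.
  apply: le_sample_mean => c; case: (bad _ _); rewrite ?(mulr1, mulr0)//.
  exact: sqr_ge0.
rewrite ler_pdivlMr// => bound; rewrite -(ler_pM2l n0) mulr1.
apply: le_trans bound.
by rewrite le_eqVlt; apply/orP; left; apply/eqP; ring.
Qed.

End chain.

End finite_sample.

(** * Transfer to an i.i.d. sample of an arbitrary law *)

Section finite_fibers.
Context d (T : measurableType d) (R : realType).

Lemma measurable_finite_fibers (K : finType) (kap : T -> K) (Q : pred K) :
  (forall k, measurable (kap @^-1` [set k])) -> measurable [set x | Q (kap x)].
Proof.
move=> mkap; rewrite [X in measurable X](_ : _ =
    \bigcup_(k in [set` enum Q]) kap @^-1` [set k]).
  by apply: fin_bigcup_measurable => // k _.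
apply/seteqP; split => [x Qx|x [k]]/=; last by rewrite mem_enum => Qk ->.
by exists (kap x) => //=; rewrite mem_enum.
Qed.

Lemma measure_finite_fibers (P : {measure set T -> \bar R}) (K : finType) (kap : T -> K)
    (Q : pred K) : (forall k, measurable (kap @^-1` [set k])) ->
  P [set x | Q (kap x)] = (\sum_(k | Q k) P (kap @^-1` [set k]))%E.
Proof.
move=> mkap; rewrite [X in P X](_ : _ =
    \bigcup_(k in [set` enum Q]) kap @^-1` [set k]); last first.
  apply/seteqP; split => [x Qx|x [k]]/=; last by rewrite mem_enum => Qk ->.
  by exists (kap x) => //=; rewrite mem_enum.
rewrite measure_fin_bigcup//.
- by rewrite -fsbig_seq ?enum_uniq// big_enum.
- by move=> k l _ _ [x [/= <- <-]].
Qed.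

End finite_fibers.

Section finite_reduction.
Context d (T : measurableType d) (R : realType).
Context (P : probability T R) (K : finType) (kap : T -> K).
Context (mkap : forall k, measurable (kap @^-1` [set k])).

Let w k : R := fine (P (kap @^-1` [set k])).
Let cells n (X : n.-tuple T) : {ffun 'I_n -> K} := [ffun i => kap (tnth X i)].

Let cells_fiberE n c : @cells n @^-1` [set c] =
  [set X | forall i, (kap @^-1` [set c i]) (tnth X i)].
Proof.
apply/seteqP; split => X /= => [<- i|h]; first by rewrite ffunE.
by apply/ffunP => i; rewrite ffunE h.
Qed.

Lemma measurable_cells n c : measurable (@cells n @^-1` [set c]).
Proof.
rewrite cells_fiberE [X in measurable X](_ : _ = \bigcap_(i : 'I_n)
   ((fun X : n.-tuple T => tnth X i) @^-1` (kap @^-1` [set c i]))).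
  apply: fin_bigcap_measurable => // i _.
  by rewrite -[X in measurable X]setTI; apply: measurable_tnth.
by apply/seteqP; split => /= X XA i => [_|]; apply: XA.
Qed.

(** This replaces the sample of law [P] by a sample from a finite set: the event is a
    disjoint union of products of cells. *)
Lemma iid_law_finite n (Q : pred {ffun 'I_n -> K}) :
  iid_law P n [set X | Q [ffun i => kap (tnth X i)]] =
  (sample_mean w (fun c => (Q c)%:R))%:E.
Proof.
rewrite (measure_finite_fibers _ (kap := @cells n))//; last first.
  exact: measurable_cells.
rewrite big_mkcond /sample_mean -sumEFin; apply: eq_bigr => c _.
case: (Q c); rewrite ?mulr0 ?mulr1// cells_fiberE.
apply: etrans (@iid_law_rectangle _ _ _ P n (fun i => kap @^-1` [set c i]) _) _ => //.
rewrite -prodEFin; apply: eq_bigr => i _.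
by rewrite fineK// fin_num_measure.
Qed.

Lemma fiber_mass_ge0 k : 0 <= w k.
Proof. by rewrite /w fine_ge0. Qed.

Lemma fiber_massE (Q : pred K) : (mass w Q)%:E = P [set x | Q (kap x)].
Proof.
rewrite measure_finite_fibers// [RHS]big_mkcond /mass -sumEFin.
apply: eq_bigr => k _; case: (Q k); rewrite ?mulr0 ?mulr1//.
by rewrite fineK// fin_num_measure.
Qed.

Lemma fiber_mass_sum : \sum_k w k = 1.
Proof.
have : (mass w predT)%:E = 1%E.
  by rewrite fiber_massE -[RHS](@probability_setT _ _ _ P); congr (P _); apply/seteqP.
by move=> [<-]; apply: eq_bigr => k _; rewrite mulr1.
Qed.

End finite_reduction.

(** For a decreasing chain of sets, the only information needed about an
    observation is how far down the chain it falls: the number [depth] of sets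
    that contain it.  This reduces the maximal inequality to the finite one. *)
Section chain_empirical.
Context d (T : measurableType d) (R : realType) (P : probability T R).
Context (A : nat -> set T) (mA : forall j, measurable (A j)).
Context (A_decr : forall j, A j.+1 `<=` A j).
Context (M : nat).

Let sub_chain j k : (j <= k)%N -> A k `<=` A j.
Proof.
move=> /subnK <-; elim: (k - j)%N => [//|d' IH] y; rewrite addSn => yA.
by apply: IH; apply: A_decr.
Qed.

Let depth (y : T) : nat := \sum_(j < M.+1) (y \in A j).

Let depthE y j : (j <= M)%N -> (j < depth y)%N = (y \in A j).
Proof.
move=> jM; rewrite /depth; apply/idP/idP.
  apply: contraTT => yNA; rewrite -leqNgt.
  rewrite (bigID (fun i : 'I_M.+1 => (i < j)%N))/= [X in (_ + X)%N]big1 ?addn0.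
    rewrite (@leq_trans (\sum_(i < M.+1 | (i < j)%N) 1)%N)//.
      by apply: leq_sum => i _; apply: leq_b1.
    by rewrite -(big_ord_widen _ (fun=> 1%N)) ?(leq_trans jM)// sum1_card card_ord.
  move=> i; rewrite -leqNgt => ji; apply/eqP; rewrite eqb0.
  apply: contra yNA; rewrite !inE; exact: sub_chain.
rewrite inE => yA.
rewrite -[X in (X <= _)%N](card_ord j.+1) -sum1_card.
rewrite (big_ord_widen M.+1 (fun=> 1%N))// big_mkcond/=.
apply: leq_sum => i _; case: ltnP => // ij.
by rewrite lt0b; rewrite inE; apply: sub_chain yA.
Qed.

Let depth_le y : (depth y < M.+2)%N.
Proof.
rewrite ltnS -[leqRHS](card_ord M.+1) -sum1_card.
by apply: leq_sum => i _; apply: leq_b1.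
Qed.

Let kap y : 'I_M.+2 := Ordinal (depth_le y).

Let measurable_kap k : measurable (kap @^-1` [set k]).
Proof.
rewrite [X in measurable X](_ : _ = \bigcap_(j in [set` 'I_M.+1])
    (if (j < k)%N then A j else ~` A j)); last first.
  apply/seteqP; split=> y /=.
    move=> yk j _; have := depthE y (ltn_ord j : (j <= M)%N).
    rewrite -yk/= => ->; case: ifPn; rewrite ?inE//= => /negP yA.
    by rewrite /setC/= => H; apply: yA; rewrite inE.
  move=> yA; apply/val_inj => /=; apply/eqP.
  have yAE j : (j <= M)%N -> (j < depth y)%N = (j < k)%N.
    move=> jM; rewrite depthE//; have := yA (Ordinal (jM : (j < M.+1)%N)) isT.
    by rewrite /=; case: ifPn => _ H; [rewrite mem_set|apply: memNset].
  case: (ltngtP (depth y) k) => // dk.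
    have dM : (depth y <= M)%N by rewrite -ltnS (leq_trans dk)// -ltnS.
    by move: (yAE _ dM); rewrite ltnn dk.
  have kM : (k < M.+1)%N := leq_trans dk (depth_le y).
  by move: (yAE k kM); rewrite ltnn dk.
apply: fin_bigcap_measurable => // j _.
by case: ifP => _ //; apply: measurableC.
Qed.

Context (x : R) (x_gt0 : 0 < x) (PA_gt0 : (0 < P (A M))%E).

Definition chain_deviation n : set (n.-tuple T) :=
  [set X | exists2 j, (j <= M)%N & x * n%:R <=
     `|(\sum_(i < n) \1_(A j) (tnth X i)) / fine (P (A j)) - n%:R|].

Let w k : R := fine (P (kap @^-1` [set k])).

Let mass_chain j : (j <= M)%N ->
  mass w (fun k : 'I_M.+2 => (j < k)%N) = fine (P (A j)).
Proof.
move=> jM; apply: EFin_inj; rewrite fiber_massE// fineK ?fin_num_measure//.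
congr (P _); apply/seteqP; split => y /=; rewrite depthE// ?inE//.
Qed.

Let deviates n (c : {ffun 'I_n -> 'I_M.+2}) : bool :=
  [exists j : 'I_M.+1, x * n%:R <=
    `|occ (fun k : 'I_M.+2 => (j < k)%N) c / mass w (fun k : 'I_M.+2 => (j < k)%N)
        - n%:R|].

Let chain_deviationE n : @chain_deviation n =
  [set X | deviates [ffun i => kap (tnth X i)]].
Proof.
have occE j (X : n.-tuple T) : (j <= M)%N ->
    occ (fun k : 'I_M.+2 => (j < k)%N) [ffun i => kap (tnth X i)] =
    \sum_(i < n) \1_(A j) (tnth X i) :> R.
  by move=> jM; apply: eq_bigr => i _; rewrite ffunE/= depthE// indicE.
apply/seteqP; split=> X /=.
  move=> [j jM]; rewrite -occE// -mass_chain// => H.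
  by apply/existsP; exists (Ordinal (jM : (j < M.+1)%N)).
move=> /existsP[j H]; have jM : (j <= M)%N by rewrite -ltnS.
by exists j => //; rewrite -occE// -mass_chain.
Qed.

Lemma measurable_chain_deviation n : measurable (@chain_deviation n).
Proof.
rewrite chain_deviationE.
exact: (measurable_finite_fibers (@deviates n)
  (measurable_cells measurable_kap (n := n))).
Qed.

Lemma chain_deviation_le n : (0 < n)%N ->
  (iid_law P n (@chain_deviation n) <=
   ((n%:R * fine (P (A M)) * x ^+ 2)^-1)%:E)%E.
Proof.
move=> n0; rewrite chain_deviationE (iid_law_finite P measurable_kap) lee_fin.
have PM : 0 < fine (P (A M)).
  by rewrite fine_gt0// PA_gt0/= ltey_eq fin_num_measure.
rewrite -[leRHS]mul1r ler_pdivlMr; last by rewrite !mulr_gt0 ?exprn_gt0// ltr0n.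
rewrite mulrC -(mass_chain (leqnn M)).
apply: (@chain_maximal_inequality R 'I_M.+2 w n (fiber_mass_ge0 P kap)
  (fiber_mass_sum P measurable_kap) (fun j k => (j < k)%N)) => //.
- by move=> j k; apply: ltnW.
- move=> j jM; rewrite mass_chain//.
  apply: lt_le_trans PM _; rewrite fine_le ?fin_num_measure//.
  by apply: le_measure; rewrite ?inE//; exact: sub_chain.
Qed.

End chain_empirical.

(** * Integration against a density and against the law of a sample *)

Section density_integral.
Context {R : realType} (f : decreasing_density R).
Local Notation mu := (@lebesgue_measure R).
Local Notation I := (`[(-1)%R, +oo[%classic : set R).
Import HBNNSimple.

Let mI : measurable I := measurable_itv (Interval _ _).

Let mf : measurable_fun I (EFin \o f).
Proof. by apply/measurable_EFinP; exact: measurable_density. Qed.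

Let f_ge0 x : I x -> (0 <= (f x)%:E)%E.
Proof. by rewrite /= in_itv/= andbT => x1; rewrite lee_fin density_ge0. Qed.

(** Both sides are continuous along the increasing approximation of [g] by simple
    functions, and agree on indicators by definition of [density_law]. *)
Lemma ge0_integral_density (g : R -> \bar R) :
  measurable_fun setT g -> (forall x, 0 <= g x)%E ->
  (\int[density_law f]_x g x = \int[mu]_(x in I) (g x * (f x)%:E))%E.
Proof.
move=> mg g0; pose h := nnsfun_approx measurableT mg.
have mh n : measurable_fun setT (h n) by exact: measurable_funP.
have mfib n y : measurable (h n @^-1` [set y]) by exact: measurable_funPTI.
have mind n y : measurable_fun setT (fun x : R => (\1_(h n @^-1` [set y]) x)%:E).
  exact/measurable_EFinP/measurable_indic.
have mterm n y : measurable_fun setT (fun x : R => (y * \1_(h n @^-1` [set y]) x)%:E).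
  by apply/measurable_EFinP/measurable_funM => //; apply/measurable_EFinP; exact: mind.
have h_cvg x : (EFin \o h ^~ x) n @[n --> \oo] --> g x.
  by apply: cvg_nnsfun_approx => // *; exact: g0.
have h_nd x m n : (m <= n)%N -> h m x <= h n x.
  by move=> mn; exact/lefP/nd_nnsfun_approx.
have -> : (\int[density_law f]_x g x =
    limn (fun n => \int[density_law f]_x (h n x)%:E))%E.
  under eq_integral => x _ do rewrite -(cvg_lim _ (h_cvg x))//.
  apply: monotone_convergence => //.
  - by move=> n; exact/measurable_EFinP/measurable_funP.
  - by move=> n x _; rewrite lee_fin.
  - by move=> x _ m n mn; rewrite lee_fin h_nd.
have -> : (\int[mu]_(x in I) (g x * (f x)%:E) =
    limn (fun n => \int[mu]_(x in I) ((h n x)%:E * (f x)%:E)))%E.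
  have E x : I x -> (g x * (f x)%:E = limn (fun n => (h n x)%:E * (f x)%:E))%E.
    move=> Ix; apply/esym/cvg_lim => //; apply: cvgeZr => //; exact: h_cvg.
  under eq_integral => x /[!inE] /E -> //.
  apply: monotone_convergence => //.
  - move=> n; apply: emeasurable_funM => //.
    by apply: measurable_funTS; apply/measurable_EFinP; exact: mh.
  - by move=> n x Ix; rewrite mule_ge0 ?f_ge0// lee_fin.
  - by move=> x Ix m n mn; rewrite lee_wpmul2r ?f_ge0// lee_fin h_nd.
congr (limn _); apply/funext => n.
under eq_integral do rewrite fimfunE -fsumEFin//.
rewrite ge0_integral_fsum//; last 2 first.
- by move=> y; exact: mterm.
- by move=> y x _; rewrite nnfun_muleindic_ge0.
under [RHS]eq_integral => x xI.
  rewrite fimfunE -fsumEFin// ge0_mule_fsuml; last first.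
    by move=> y; rewrite nnfun_muleindic_ge0.
  over.
rewrite ge0_integral_fsum//; last 2 first.
- move=> y; apply: emeasurable_funM => //; apply: measurable_funTS.
  exact: mterm.
- by move=> y x Ix; rewrite mule_ge0 ?f_ge0// nnfun_muleindic_ge0.
apply: eq_fsbigr => r /[!inE] -[x0 _ hr].
have r0 : (0 <= r)%R by rewrite -hr.
under eq_integral do rewrite EFinM.
rewrite ge0_integralZl//=.
rewrite integral_indic// setIT.
under [RHS]eq_integral do rewrite EFinM -muleA.
rewrite [RHS]ge0_integralZl//; last 2 first.
- apply: emeasurable_funM => //; apply: measurable_funTS; exact: mind.
- by move=> x Ix; rewrite mule_ge0 ?f_ge0// lee_fin.
congr (_ * _)%E; rewrite /= /density_law setIC integral_mkcondr.
apply: eq_integral => x xI; rewrite patchE indicE.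
by case: ifPn => _; rewrite ?mul1e ?mul0e.
Qed.

End density_integral.

Section iid_integral.
Context d (T : measurableType d) (R : realType).

(** The integral of a nonnegative function is a supremum over the simple functions
    below it, and this supremum is monotone for arbitrary functions. *)
Lemma le_integral_ge0 d' (T' : measurableType d') (mu : {measure set T' -> \bar R})
    (f g : T' -> \bar R) : (forall x, 0 <= f x)%E -> (forall x, f x <= g x)%E ->
  (\int[mu]_x f x <= \int[mu]_x g x)%E.
Proof.
move=> f0 fg; rewrite !ge0_integralTE//; last first.
  by move=> x; exact: le_trans (f0 x) (fg x).
by apply: le_ereal_sup => _ [h hf <-]; exists h => // x; exact: le_trans (hf x) (fg x).
Qed.

(** Monotonicity on arbitrary sets.  The events about the Grenander estimator are
    handled through measurable events that contain them, and this lemma is all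
    that relates the two. *)
Lemma iid_law_mono (P : probability T R) n (A B : set (n.-tuple T)) : A `<=` B ->
  (iid_law P n A <= iid_law P n B)%E.
Proof.
elim: n A B => [|n IH] A B AB; rewrite /=.
  rewrite !diracE; case: (boolP ([tuple] \in A)) => [/[!inE]/AB tB|_].
    by rewrite mem_set.
  by rewrite lee_fin ler0n.
rewrite /distribution /pushforward /product_measure1.
apply: le_integral_ge0 => x //=; apply: IH => t; rewrite /xsection/= !inE.
exact: AB.
Qed.

Lemma iid_integralS (P : probability T R) n (phi : n.+1.-tuple T -> \bar R) :
  measurable_fun setT phi -> (forall X, 0 <= phi X)%E ->
  (\int[iid_law P n.+1]_X phi X =
   \int[P]_x \int[iid_law P n]_t phi (tuple_cons (x, t)))%E.
Proof.
move=> mphi phi0; rewrite /= ge0_integral_pushforward//.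
rewrite fubini_tonelli1//; first exact: measurableT_comp.
by move=> x; exact: phi0.
Qed.

Lemma measurable_iid_section (P : probability T R) n (phi : n.+1.-tuple T -> \bar R) :
  measurable_fun setT phi -> (forall X, 0 <= phi X)%E ->
  measurable_fun setT (fun x => \int[iid_law P n]_t phi (tuple_cons (x, t)))%E.
Proof.
move=> mphi phi0.
apply: (@measurable_fun_fubini_tonelli_F _ _ _ _ _ (iid_law P n) (phi \o @tuple_cons _ T n)).
  exact: measurableT_comp.
by move=> x; exact: phi0.
Qed.

(** For [P] with density [p] with respect to [Q], the least such [K] is the second
    moment of [p] under [Q], that is, 1 plus the chi-square distance.  This
    form of the bound mentions no density and is stable under products. *)
Definition second_moment_dominated d' (T' : measurableType d')
  (P Q : probability T' R) (K : R) := forall (C : R) (g : T' -> \bar R),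
  measurable_fun setT g -> (forall x, 0 <= g x <= C%:E)%E ->
  ((\int[P]_x g x) * (\int[P]_x g x) <= K%:E * \int[Q]_x (g x * g x))%E.

(** The bound tensorizes: it is applied to the first coordinate, for the partial
    integral of [phi] over the others, and then by induction to the others. *)
Lemma second_moment_dominated_iid (P Q : probability T R) (K : R) n : 0 <= K ->
  second_moment_dominated P Q K ->
  second_moment_dominated (iid_law P n) (iid_law Q n) (K ^+ n).
Proof.
move=> K0 PQ; elim: n => [|n IH] C phi mphi phiC.
  rewrite /= !integral_dirac ?diracT ?mul1e ?expr0 ?mul1e//.
  exact: emeasurable_funM.
have phi0 X : (0 <= phi X)%E by case/andP: (phiC X).
have phiC' X : (phi X <= C%:E)%E by case/andP: (phiC X).
have mphi2 : measurable_fun setT (fun X => phi X * phi X)%E.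
  exact: emeasurable_funM.
have sq_ge0 X : (0 <= phi X * phi X)%E by rewrite mule_ge0.
have msec x : measurable_fun setT (fun t => phi (tuple_cons (x, t))).
  apply: measurableT_comp => //; apply: measurableT_comp => //.
rewrite !iid_integralS//.
apply: le_trans (PQ C _ (measurable_iid_section _ _ _) _) _ => //.
  move=> x; rewrite integral_ge0//=.
  apply: (@le_trans _ _ (\int[iid_law P n]_t (cst C%:E t))%E).
    exact: le_integral_ge0.
  rewrite integral_cst// [X in (_ * X)%E](_ : _ = 1%E) ?mule1//.
  exact: probability_setT.
rewrite exprS EFinM -muleA lee_wpmul2l ?lee_fin//.
rewrite -ge0_integralZl//; last 3 first.
- exact: (@measurable_iid_section Q n _ mphi2 sq_ge0).
- by move=> x _; apply: integral_ge0.
- by rewrite lee_fin exprn_ge0.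
apply: le_integral_ge0 => x; first by rewrite mule_ge0// integral_ge0.
by apply: (IH C) => // t; rewrite phi0 phiC'.
Qed.

End iid_integral.

(** * From second moments to total variation *)

Section total_variation.
Context d (T : measurableType d) (R : realType) (P Q : probability T R).

(** The bound applied to the indicator of [A] would give P(A)^2 <= K Q(A), which
    does not bring P(A) close to Q(A) as K tends to 1.  Applied to 1 + t 1_A with a small t,
    it linearizes to P(A) - Q(A) <= (K - 1)/(2t) + O(t); t = eps/2 balances the
    two terms. *)
Lemma second_moment_total_variation (K eps : R) : 0 < eps <= 1 ->
  K <= 1 + eps ^+ 2 / 4 -> second_moment_dominated P Q K ->
  forall A, measurable A -> (P A <= Q A + eps%:E)%E /\ (Q A <= P A + eps%:E)%E.
Proof.
move=> /andP[e0 e1] Ke PQ.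
suff le A : measurable A -> (P A <= Q A + eps%:E)%E.
  move=> A mA; split; first exact: le.
  have := le _ (measurableC mA); rewrite !probability_setC//.
  rewrite -(fineK (fin_num_measure P A mA)) -(fineK (fin_num_measure Q A mA)).
  by rewrite -!EFinB -!EFinD !lee_fin; lra.
move=> mA; pose t := eps / 2.
have t0 : 0 < t by rewrite /t; lra.
pose phi x : \bar R := (1 + t * \1_A x)%:E.
have mphi c : measurable_fun setT (fun x => (1 + c * \1_A x)%:E : \bar R).
  apply/measurable_EFinP/measurable_funD => //; apply: measurable_funM => //.
have int_phi (S : probability T R) c : 0 <= c ->
    (\int[S]_x (1 + c * \1_A x)%:E = 1 + c%:E * S A)%E.
  move=> c0; under eq_integral do rewrite EFinD EFinM.
  have mind : measurable_fun setT (fun x => (\1_A x)%:E : \bar R).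
    exact/measurable_EFinP/measurable_indic.
  rewrite ge0_integralD//; last 2 first.
  - by move=> x _; rewrite -EFinM lee_fin mulr_ge0.
  - by apply: emeasurable_funM.
  rewrite integral_cst// [X in (_ * X + _)%E](_ : _ = 1%E) ?mule1; last first.
    exact: probability_setT.
  by rewrite ge0_integralZl// integral_indic// setIT.
have := PQ (1 + t) phi (mphi t).
have -> : (\int[Q]_x (phi x * phi x) = 1 + (2 * t + t ^+ 2)%:E * Q A)%E.
  rewrite -int_phi; last by rewrite addr_ge0 ?mulr_ge0 ?sqr_ge0// ltW.
  apply: eq_integral => x _; rewrite /phi -EFinM indicE; congr EFin.
  by case: (x \in A); rewrite /=; ring.
rewrite (int_phi P t (ltW t0)) -(fineK (fin_num_measure P A mA)) -(fineK (fin_num_measure Q A mA)).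
have q0 : 0 <= fine (Q A) by rewrite fine_ge0.
have q1 : fine (Q A) <= 1.
  by rewrite -lee_fin fineK ?fin_num_measure ?probability_le1.
move: (fine (P A)) (fine (Q A)) q0 q1 => p q q0 q1 H.
have {H} : (1 + t * p) * (1 + t * p) <= K * (1 + (2 * t + t ^+ 2) * q).
  rewrite -lee_fin !EFinM !EFinD !EFinM; apply: H => x.
  rewrite /phi !lee_fin indicE; case: (x \in A) => /=; apply/andP; split; lra.
have Hq : 0 <= 1 + (2 * t + t ^+ 2) * q.
  by rewrite addr_ge0// mulr_ge0// addr_ge0 ?mulr_ge0 ?sqr_ge0// ltW.
move=> /le_trans/(_ (ler_wpM2r Hq Ke)) H.
rewrite -EFinD lee_fin.
have e2 : eps = 2 * t by rewrite /t; lra.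
have t12 : t <= 2^-1 by rewrite /t; lra.
rewrite e2 in H *; rewrite -(ler_pM2l t0).
have : t * q <= t by rewrite ler_piMr// ltW.
have : t ^+ 2 * q <= t ^+ 2 by rewrite ler_piMr ?sqr_ge0.
have : t ^+ 2 * (2 * t + t ^+ 2) * q <= t ^+ 2 * (5 / 4).
  rewrite -mulrA ler_wpM2l ?sqr_ge0//; nra.
have := sqr_ge0 (t * p).
nra.
Qed.

End total_variation.

Section density_second_moment.
Context {R : realType} (p q : decreasing_density R).
Local Notation mu := (@lebesgue_measure R).
Local Notation I := (`[(-1)%R, +oo[%classic : set R).

(** Cauchy-Schwarz for (p / sqrt q) and (g sqrt q), in the form of the
    arithmetic-geometric inequality 2 t g p <= t^2 p^2/q + g^2 q integrated and
    then optimized in t. *)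
Lemma second_moment_dominated_density (K : R) : 0 < K ->
  (forall x, -1 <= x -> q x = 0 -> p x = 0) ->
  (\int[mu]_(x in I) (p x ^+ 2 / q x)%:E <= K%:E)%E ->
  second_moment_dominated (density_law p) (density_law q) K.
Proof.
move=> K0 pq pqK C g mg gC.
have g0 x : (0 <= g x)%E by case/andP: (gC x).
have gfin x : g x \is a fin_num.
  by rewrite ge0_fin_numE//; case/andP: (gC x) => _ /le_lt_trans; apply; rewrite ltry.
have mI : measurable I := measurable_itv (Interval _ _).
have mp : measurable_fun I (p : R -> R) by exact: measurable_density.
have mq : measurable_fun I (q : R -> R) by exact: measurable_density.
have mgI : measurable_fun I g by apply: measurable_funTS.
have Ip x : I x -> 0 <= p x by rewrite /= in_itv/= andbT; exact: density_ge0.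
have Iq x : I x -> 0 <= q x by rewrite /= in_itv/= andbT; exact: density_ge0.
have C0 : 0 <= C by rewrite -lee_fin; case/andP: (gC 0) => /le_trans; apply.
have Pg : (\int[density_law p]_x g x <= C%:E)%E.
  apply: (@le_trans _ _ (\int[density_law p]_x (cst C%:E x))%E).
    by apply: le_integral_ge0 => // x; case/andP: (gC x).
  rewrite integral_cst// [X in (_ * X)%E](_ : _ = 1%E) ?mule1//.
  exact: probability_setT.
have Pg0 : (0 <= \int[density_law p]_x g x)%E by apply: integral_ge0.
have amgm t : 0 <= t -> ((2 * t)%:E * \int[density_law p]_x g x <=
    (t ^+ 2 * K)%:E + \int[density_law q]_x (g x * g x))%E.
  move=> t0.
  have mpq : measurable_fun I (fun x => (p x ^+ 2 / q x)%:E : \bar R).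
    apply/measurable_EFinP/measurable_funM; first exact: measurable_funX.
    (* the power function with exponent -1 vanishes at 0, as the inverse does *)
    apply: (eq_measurable_fun (fun x => q x `^ (-1))) => [x /[!inE] Ix|].
      by rewrite powR_inv1// Iq.
    exact: (measurableT_comp (measurable_powR (-1)) mq).
  have pq0 x : I x -> (0 <= (p x ^+ 2 / q x)%:E)%E.
    by move=> Ix; rewrite lee_fin divr_ge0 ?sqr_ge0 ?Iq.
  rewrite !ge0_integral_density//; [|exact: emeasurable_funM|by move=> x; rewrite mule_ge0].
  apply: (@le_trans _ _ (\int[mu]_(x in I) ((t ^+ 2)%:E * (p x ^+ 2 / q x)%:E +
      g x * g x * (q x)%:E))%E).
    rewrite -ge0_integralZl//; last 3 first.
    - by apply: emeasurable_funM => //; apply/measurable_EFinP.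
    - by move=> x Ix; rewrite mule_ge0// lee_fin Ip.
    - by rewrite lee_fin mulr_ge0.
    apply: ge0_le_integral => //.
    - by move=> x Ix; rewrite !mule_ge0 ?lee_fin ?Ip// mulr_ge0.
    - apply: emeasurable_funM => //; apply: emeasurable_funM => //.
      exact/measurable_EFinP.
    - apply: emeasurable_funD; first by apply: emeasurable_funM.
      apply: emeasurable_funM; first by apply: emeasurable_funM.
      exact/measurable_EFinP.
    - move=> x Ix; rewrite -(fineK (gfin x)) -!EFinM -EFinD lee_fin.
      have := Ip _ Ix; have := Iq _ Ix; move: (fine (g x)) => y.
      have [q0|q0] := eqVneq (q x) 0.
        by rewrite pq// ?mul0r ?mulr0 ?expr0n/= ?mul0r ?mulr0 ?q0 ?mulr0 ?addr0//;
           move: Ix; rewrite /= in_itv/= andbT.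
      move=> qx px; rewrite -subr_ge0.
      have -> : t ^+ 2 * (p x ^+ 2 / q x) + y * y * q x - 2 * t * (y * p x) =
        (t * p x - y * q x) ^+ 2 / q x by field.
      by rewrite divr_ge0 ?sqr_ge0.
  rewrite ge0_integralD//; last 4 first.
  - by move=> x Ix; rewrite mule_ge0 ?pq0// lee_fin sqr_ge0.
  - by apply: emeasurable_funM.
  - by move=> x Ix; rewrite !mule_ge0// lee_fin Iq.
  - apply: emeasurable_funM; first by apply: emeasurable_funM.
    exact/measurable_EFinP.
  rewrite leeD2r// ge0_integralZl//; last by rewrite lee_fin sqr_ge0.
  by rewrite [(t ^+ 2 * K)%:E]EFinM lee_wpmul2l// lee_fin sqr_ge0.
have Qg0 : (0 <= \int[density_law q]_x (g x * g x))%E.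
  by apply: integral_ge0 => x _; rewrite mule_ge0.
move: amgm Pg Pg0 Qg0.
move: (\int[density_law q]_x _)%E (\int[density_law p]_x _)%E => [b| |] [a| |]//=;
  last first.
  by move=> _ _ _ _; rewrite mulry gtr0_sg// mul1e leey.
move=> amgm _; rewrite !lee_fin => a0 b0.
have := amgm (a / K) (divr_ge0 a0 (ltW K0)).
rewrite lee_fin => H; rewrite [K * b]mulrC -ler_pdivrMr//.
move: H; have -> : (a / K) ^+ 2 * K = a * a / K by field; exact: lt0r_neq0.
have -> : 2 * (a / K) * a = 2 * (a * a / K) by ring.
lra.
Qed.

End density_second_moment.

(** * The slope of the least concave majorant at 0 *)

Section grenander_slope.
Context {R : realType} {n : nat} (X : n.-tuple R).
Implicit Types a b m s t h k u y : R.
Local Notation F := (empirical_cdf X).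
Local Notation C := (concave_majorant X).

Lemma empirical_cdf_nondecreasing s t : s <= t -> F s <= F t.
Proof.
move=> st; rewrite /empirical_cdf ler_wpM2r ?invr_ge0// ler_sum// => i _.
by case: (leP (tnth X i) s) => [/le_trans/(_ st)->//|_]; rewrite ler0n.
Qed.

Lemma empirical_cdf_ge0 s : 0 <= F s.
Proof. by rewrite divr_ge0// sumr_ge0. Qed.

Lemma empirical_cdf_le1 s : F s <= 1.
Proof.
rewrite /empirical_cdf; have [n0|n0] := eqVneq (n%:R : R) 0.
  by rewrite n0 invr0 mulr0.
rewrite ler_pdivrMr ?lt0r ?n0//= mul1r.
rewrite -[X in _ <= X%:R]card_ord -sum1_card natr_sum ler_sum// => i _.
by rewrite ler_nat leq_b1.
Qed.

Let majorant (a b : R) := forall s, -1 <= s -> F s <= a * s + b.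

Let C_le a b t : -1 <= t -> majorant a b -> C t <= a * t + b.
Proof.
move=> t1 ab; apply: ge_inf; last first.
  by exists (fun s => a * s + b) => //; split => //; exists a, b.
by exists (F t) => _ [phi [_ phiF] <-]; exact: phiF.
Qed.

Let C_ge y t : (forall a b, majorant a b -> y <= a * t + b) -> y <= C t.
Proof.
move=> yab; apply: lb_le_inf.
  exists 1, (fun=> 1) => //; split; first by exists 0, 1 => s; rewrite mul0r add0r.
  by move=> s _; exact: empirical_cdf_le1.
move=> _ [phi [[a [b ab]] phiF] <-]; rewrite ab; apply: yab => s s1.
by rewrite -ab phiF.
Qed.

Let slope_nonincreasing h k : 0 < h -> h <= k -> (C k - C 0) / k <= (C h - C 0) / h.
Proof.
move=> h0 hk; have k0 : 0 < k := lt_le_trans h0 hk.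
rewrite [leRHS]mulrC -ler_pdivrMl ?invr_gt0// invrK lerBrDl mulrC.
have l0 : 0 <= h / k by rewrite divr_ge0// ltW.
have l1 : h / k <= 1 by rewrite ler_pdivrMr// mul1r.
apply: C_ge => a b ab.
have Ck : C k <= a * k + b by apply: C_le => //; lra.
have C0 : C 0 <= a * 0 + b by apply: C_le => //; lra.
have kn0 : k != 0 by rewrite lt0r_neq0.
have -> : C 0 + (C k - C 0) / k * h = (1 - h / k) * C 0 + h / k * C k by field.
have -> : a * h + b = (1 - h / k) * (a * 0 + b) + h / k * (a * k + b) by field.
by rewrite lerD// ler_wpM2l// subr_ge0.
Qed.

Let C_increment m s h : -1 <= s <= 0 -> 0 <= h ->
  (forall t, 0 <= t -> F t - F s <= m * (t - s)) -> C h <= C 0 + m * h.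
Proof.
move=> /andP[s1 s0] h0 Fm; rewrite -lerBlDr; apply: C_ge => a b ab.
rewrite lerBlDr mulr0 add0r.
have [am|ma] := leP a m.
  apply: (@le_trans _ _ (a * h + b)); first by apply: C_le => //; lra.
  by rewrite addrC lerD2l ler_wpM2r.
have -> : b + m * h = m * h + b by rewrite addrC.
apply: C_le => [|t t1]; first by lra.
have [t0|t0] := leP t 0; first by have := ab _ t1; nra.
by have := Fm _ (ltW t0); have := ab _ s1; nra.
Qed.

Let slope_le1 h : 0 < h -> (C h - C 0) / h <= 1.
Proof.
move=> h0; rewrite ler_pdivrMr// lerBlDl; apply: (@C_increment 1 (-1)); [lra|lra|].
move=> t t0; have := empirical_cdf_le1 t; have := empirical_cdf_ge0 (-1); lra.
Qed.

Let slope_cvg : cvg ((C (0 + h) - C 0) / h @[h --> 0^'+]).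
Proof.
under eq_fun do rewrite add0r.
apply: nonincreasing_at_right_is_cvgr; near=> x.
  move=> h k; rewrite !in_itv/= => /andP[h0 _] /andP[k0 _].
  exact: slope_nonincreasing.
exists 1 => y [h] /=; rewrite in_itv/= => /andP[h0 _] <-.
exact: slope_le1.
Unshelve. all: by end_near. Qed.

(** An affine majorant that is steeper than [m] can be rotated about its value
    at 0 into one of slope [m]: the new line is larger on the left of 0, and on the
    right it stays above the line of slope [m] through (s, F s), because the
    steeper one is above it at 0.  This bounds the increments of the concave majorant
    after 0. *)
Lemma grenander_le m s : -1 <= s <= 0 ->
  (forall t, 0 <= t -> F t - F s <= m * (t - s)) -> grenander X 0 <= m.
Proof.
move=> s10 Fm; apply: limr_le; first exact: slope_cvg.
near=> h; have h0 : 0 < h by near: h; exact: nbhs_right_gt.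
by rewrite add0r ler_pdivrMr// lerBlDl; apply: C_increment s10 (ltW h0) Fm.
Unshelve. all: by end_near. Qed.

(* The empirical distribution function is constant between 0 and the first
   positive observation. *)
Let empirical_cdf_right : exists2 e : R, 0 < e & forall u, 0 <= u < e -> F u = F 0.
Proof.
exists (\big[Order.min/1]_(i < n | 0 < tnth X i) tnth X i).
  exact: lt_bigmin.
move=> u /andP[u0 ue]; congr (_ / _); apply: eq_bigr => i _; congr (_ %:R).
congr nat_of_bool; apply/idP/idP => [Xu|/le_trans]; last exact.
rewrite leNgt; apply/negP => X0.
have : u < tnth X i := lt_le_trans ue (bigmin_le_cond _ _ X0).
by rewrite ltNge Xu.
Qed.

(** Dually, an affine majorant that is flatter than [m] can be rotated about its
    value at a small [h > 0].  Between 0 and [h] the new line could fail to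
    dominate F, unless F is constant there, which holds for small [h]. *)
Lemma grenander_ge m t : 0 <= m -> 0 < t ->
  (forall s, -1 <= s <= 0 -> m * (t - s) <= F t - F s) -> m <= grenander X 0.
Proof.
move=> m0 t0 Fm; have [e e0 Fe] := empirical_cdf_right.
apply: limr_ge; first exact: slope_cvg.
near=> h; have h0 : 0 < h by near: h; exact: nbhs_right_gt.
have he : h < e by near: h; exact: nbhs_right_lt.
have ht : h < t by near: h; exact: nbhs_right_lt.
rewrite add0r ler_pdivlMr// lerBrDr; apply: C_ge => a b ab.
rewrite -lerBrDl.
have [ma|am] := leP m a.
  have : C 0 <= a * 0 + b by apply: C_le => //; lra.
  nra.
have -> : a * h + b - m * h = m * 0 + (a * h + b - m * h) by rewrite mulr0 add0r.
have Fneg u : -1 <= u <= 0 -> F u <= m * u + (a * h + b - m * h).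
  move=> u10; have := Fm _ u10; have : -1 <= t by lra.
  by move=> /ab; nra.
apply: C_le => [|u u1]; first by lra.
have [u0|u0] := leP u 0; first by rewrite Fneg// u1.
have [uh|hu] := ltP u h; last by have := ab _ u1; nra.
rewrite Fe ?(ltW u0) ?(lt_trans uh)//.
have : F 0 <= m * 0 + (a * h + b - m * h) by apply: Fneg; lra.
by have := mulr_ge0 m0 (ltW u0); lra.
Unshelve. all: by end_near. Qed.

Lemma grenander_ge0 : 0 <= grenander X 0.
Proof.
apply: (@grenander_ge 0 1) => // s /andP[_ s0].
rewrite mul0r subr_ge0; apply: empirical_cdf_nondecreasing; lra.
Qed.

End grenander_slope.

(** * Tail bounds for the Grenander estimator at 0 *)

Section density_law_interval.
Context {R : realType} (f : decreasing_density R).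
Local Notation mu := (@lebesgue_measure R).
Local Notation P := (density_law f).

Let mI : measurable (`[(-1)%R, +oo[%classic : set R) := measurable_itv (Interval _ _).

Lemma density_law_itvE x y : -1 <= x ->
  P `]x, y]%classic = (\int[mu]_(z in `]x, y]%classic) (f z)%:E)%E.
Proof.
move=> x1; rewrite /= /density_law; congr (integral _ _ _).
apply/setIidPl => z /=; rewrite !in_itv/= andbT => /andP[xz _].
exact: le_trans x1 (ltW xz).
Qed.

Let measurable_f x y : -1 <= x ->
  measurable_fun (`]x, y]%classic : set R) (EFin \o f).
Proof.
move=> x1; apply/measurable_EFinP; apply: measurable_funS (measurable_density f) => //.
move=> z /=; rewrite !in_itv/= andbT => /andP[xz _].
exact: le_trans x1 (ltW xz).
Qed.

Let int_cst x y c : x <= y ->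
  (\int[mu]_(z in `]x, y]%classic) (cst c%:E z) = (c * (y - x))%:E)%E.
Proof.
move=> xy; rewrite integral_cst//= lebesgue_measure_itv/= lte_fin.
case: ltP => [_|yx]; first by rewrite -EFinD -EFinM.
have -> : y = x by apply/eqP; rewrite eq_le yx xy.
by rewrite subrr mulr0 mule0.
Qed.

Definition prob_itv x y : R := fine (P `]x, y]%classic).

Lemma prob_itvE x y : (prob_itv x y)%:E = P `]x, y]%classic.
Proof. by rewrite fineK// fin_num_measure. Qed.

Lemma prob_itv_le x y : -1 <= x -> x <= y -> prob_itv x y <= f x * (y - x).
Proof.
move=> x1 xy; rewrite -lee_fin prob_itvE density_law_itvE// -int_cst//.
apply: ge0_le_integral => //.
- move=> z /=; rewrite in_itv/= => /andP[xz _]; rewrite lee_fin density_ge0//.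
  exact: le_trans x1 (ltW xz).
- exact: measurable_f.
- move=> z /=; rewrite in_itv/= => /andP[xz _]; rewrite lee_fin.
  by apply: density_decreasing => //; exact: ltW.
Qed.

Lemma prob_itv_ge x y : -1 <= x -> x <= y -> f y * (y - x) <= prob_itv x y.
Proof.
move=> x1 xy; rewrite -lee_fin prob_itvE density_law_itvE// -int_cst//.
apply: ge0_le_integral => //.
- by move=> z _; rewrite lee_fin density_ge0// (le_trans x1).
- exact: measurable_f.
- move=> z /=; rewrite in_itv/= => /andP[xz zy]; rewrite lee_fin.
  by apply: density_decreasing => //; exact: le_trans x1 (ltW xz).
Qed.

Lemma prob_itvD x y z : x <= y -> y <= z ->
  prob_itv x z = prob_itv x y + prob_itv y z.
Proof.
move=> xy yz; apply: EFin_inj; rewrite EFinD !prob_itvE -measureU//; last first.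
  apply/seteqP; split => // t [] /=; rewrite !in_itv/= => /andP[_ ty] /andP[].
  by rewrite ltNge ty.
congr (P _); apply/seteqP; split => t /=; rewrite !in_itv/=.
  by move=> /andP[xt tz]; case: (leP t y) => ty; [left; rewrite xt|right].
move=> [/andP[xt ty]|/andP[yt tz]].
  by rewrite xt (le_trans ty).
by rewrite tz (le_lt_trans xy).
Qed.

Lemma prob_itv_le1 x y : prob_itv x y <= 1.
Proof. by rewrite -lee_fin prob_itvE probability_le1. Qed.

End density_law_interval.

Section grenander_tails.
Context {R : realType} (f : decreasing_density R).
Local Notation P := (density_law f).

Lemma empirical_cdf_itv n (X : n.-tuple R) (x y : R) : x <= y ->
  (\sum_(i < n) \1_(`]x, y]%classic) (tnth X i)) / n%:R =
  empirical_cdf X y - empirical_cdf X x.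
Proof.
move=> xy; rewrite /empirical_cdf -mulrBl -sumrB; congr (_ / _).
apply: eq_bigr => i _; rewrite indicE mem_setE in_itv/=.
have [Xx|xX] := leP (tnth X i) x; first by rewrite (le_trans Xx xy)/= subrr.
by rewrite subr0.
Qed.

(** The intervals ]-h, t] with t >= 0 decrease to ]-h, 0], which has probability at
    least f(0) h, while ]-h, t] has probability at most f(-h) (h + t).  One factor
    1 + x pays for the relative deviation, the other for restricting t to
    multiples of x h. *)
Lemma grenander_upper_tail (h x : R) n : (0 < n)%N -> 0 < h <= 1 -> 0 < x -> 0 < f 0 ->
  exists E : set (n.-tuple R), [/\ measurable E,
    (iid_law P n E <= ((n%:R * (f 0 * h) * x ^+ 2)^-1)%:E)%E &
    forall X, ~ E X -> grenander X 0 <= (1 + x) ^+ 2 * f (- h)].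
Proof.
move=> n0 /andP[h0 h1] x0 f00.
have h10 : -1 <= - h by rewrite lerN2.
have f0h : f 0 <= f (- h) by apply: density_decreasing => //; rewrite oppr_le0 ltW.
have fh0 : 0 < f (- h) := lt_le_trans f00 f0h.
set m := (1 + x) ^+ 2 * f (- h).
have m0 : 0 < m by rewrite mulr_gt0// exprn_gt0// ltr_pwDl// ltW.
pose dl := x * h; have dl0 : 0 < dl by rewrite mulr_gt0.
(* beyond M dl the line of slope m exceeds 1, hence every increment of F_n *)
pose M := (Num.truncn (m * dl)^-1).+1.
have M1 : 1 <= m * (M%:R * dl).
  rewrite mulrCA -ler_pdivrMr ?(mulr_gt0 m0 dl0)// div1r ltW// /M; exact: truncnS_gt.
pose A j : set R := `]- h, (M - j)%:R * dl]%classic.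
have mA j : measurable (A j) by exact: measurable_itv.
have A_decr j : A j.+1 `<=` A j.
  move=> z; rewrite /A /= !in_itv/= => /andP[-> /le_trans]; apply.
  by rewrite ler_pM2r// ler_nat leq_sub2l.
have PAM : f 0 * h <= fine (P (A M)).
  rewrite /A subnn mul0r; have := @prob_itv_ge _ f _ 0 h10.
  by rewrite oppr_le0 sub0r opprK; apply; exact: ltW.
have PAM0 : (0 < P (A M))%E.
  by rewrite -[P _]prob_itvE lte_fin (lt_le_trans _ PAM)// mulr_gt0.
have nR : 0 < n%:R :> R by rewrite ltr0n.
exists (chain_deviation P A M x (n := n)); split.
- exact: measurable_chain_deviation.
- apply: le_trans (chain_deviation_le mA A_decr x0 PAM0 n0) _.
  have PAMR : 0 < fine (P (A M)) by apply: lt_le_trans PAM; rewrite mulr_gt0.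
  rewrite lee_fin lef_pV2 ?posrE ?mulr_gt0 ?exprn_gt0//.
  by rewrite ler_pM2r ?exprn_gt0// ler_pM2l.
move=> X XE; apply: (@grenander_le _ _ _ _ (- h)); first by lra.
move=> t t0; rewrite opprK.
have [tM|Mt] := ltP t (M%:R * dl); last first.
  have := empirical_cdf_le1 X t; have := empirical_cdf_ge0 X (- h).
  have : m * (M%:R * dl) <= m * (t + h) by rewrite ler_pM2l//; lra.
  lra.
pose k := (Num.truncn (t / dl)).+1.
have tk : t <= k%:R * dl by rewrite -ler_pdivrMr// ltW// truncnS_gt.
have kt : k%:R * dl <= t + dl.
  by rewrite -natr1 mulrDl mul1r lerD2r -ler_pdivlMr// truncn_le// divr_ge0// ltW.
have kM : (k <= M)%N.
  rewrite -ltnS -(ltr_nat R) -natr1 -(ltr_pM2r dl0) mulrDl mul1r.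
  by apply: le_lt_trans kt _; rewrite ltrD2r.
have pk : prob_itv f (- h) (k%:R * dl) <= f (- h) * (k%:R * dl + h).
  by apply: le_trans (prob_itv_le _ _ _) _ => //; lra.
have pk0 : 0 < prob_itv f (- h) (k%:R * dl).
  apply: lt_le_trans (mulr_gt0 f00 h0) _; apply: (le_trans PAM).
  have mh0 : - h <= 0 by lra.
  rewrite /A subnn mul0r -/(prob_itv f _ _) (prob_itvD f mh0 (le_trans t0 tk)).
  by rewrite lerDl fine_ge0.
have dev : (\sum_(i < n) \1_(A (M - k)%N) (tnth X i)) / n%:R <=
    (1 + x) * prob_itv f (- h) (k%:R * dl).
  rewrite leNgt; apply/negP => H; apply: XE; exists (M - k)%N; first exact: leq_subr.
  move: H; rewrite /A subKn// -/(prob_itv f _ _).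
  move: (\sum_(i < n) _) => S; rewrite ltr_pdivlMr// => H.
  rewrite ler_normr; apply/orP; left.
  rewrite lerBrDr ler_pdivlMr//; nra.
move: dev; rewrite /A subKn// empirical_cdf_itv; last by lra.
have := @empirical_cdf_nondecreasing _ _ X _ _ tk.
have : f (- h) * (k%:R * dl + h) <= f (- h) * ((1 + x) * (t + h)).
  rewrite ler_pM2l//; rewrite /dl in kt *; nra.
rewrite /m; nra.
Qed.

(** The same argument for the intervals ]s, h] with s in [-1, 0].  Here the mesh is
    1/M, so that the grid ends exactly at -1, where the density begins. *)
Lemma grenander_lower_tail (h x : R) n : (0 < n)%N -> 0 < h -> 0 < x <= 1 -> 0 < f h ->
  exists E : set (n.-tuple R), [/\ measurable E,
    (iid_law P n E <= ((n%:R * (f h * h) * x ^+ 2)^-1)%:E)%E &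
    forall X, ~ E X -> (1 - x) ^+ 2 * f h <= grenander X 0].
Proof.
move=> n0 h0 /andP[x0 x1] fh0.
pose M := (Num.truncn (x * h)^-1).+1.
have M0 : 0 < M%:R :> R by rewrite ltr0n.
pose dl : R := M%:R^-1; have dl0 : 0 < dl by rewrite invr_gt0.
have dlx : dl <= x * h.
  rewrite /dl -[leRHS]invrK lef_pV2 ?posrE ?invr_gt0 ?mulr_gt0//.
  by rewrite ltW// truncnS_gt.
have Mdl : M%:R * dl = 1 by rewrite mulfV// lt0r_neq0.
pose A j : set R := `]- ((M - j)%:R * dl), h]%classic.
have mA j : measurable (A j) by exact: measurable_itv.
have A_decr j : A j.+1 `<=` A j.
  move=> z; rewrite /A /= !in_itv/= => /andP[zj ->]; rewrite andbT.
  by apply: le_lt_trans zj; rewrite lerN2 ler_pM2r// ler_nat leq_sub2l.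
have PAM : f h * h <= fine (P (A M)).
  rewrite /A subnn mul0r oppr0; have := @prob_itv_ge _ f 0 h.
  by rewrite subr0; apply; [lra|exact: ltW].
have PAM0 : (0 < P (A M))%E.
  by rewrite -[P _]prob_itvE lte_fin (lt_le_trans _ PAM)// mulr_gt0.
have nR : 0 < n%:R :> R by rewrite ltr0n.
exists (chain_deviation P A M x (n := n)); split.
- exact: measurable_chain_deviation.
- apply: le_trans (chain_deviation_le mA A_decr x0 PAM0 n0) _.
  have PAMR : 0 < fine (P (A M)) by apply: lt_le_trans PAM; rewrite mulr_gt0.
  rewrite lee_fin lef_pV2 ?posrE ?mulr_gt0 ?exprn_gt0//.
  by rewrite ler_pM2r ?exprn_gt0// ler_pM2l.
move=> X XE; apply: (@grenander_ge _ _ _ _ h) => //.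
  by rewrite mulr_ge0 ?sqr_ge0// ltW.
move=> s /andP[s1 s0].
pose k := Num.truncn (- s / dl).
have ks : k%:R * dl <= - s.
  by rewrite -ler_pdivlMr// truncn_le divr_ge0// ?oppr_ge0// ltW.
have sk : - s <= k%:R * dl + dl.
  by rewrite -[X in _ + X]mul1r -mulrDl natr1 -ler_pdivrMr// ltW// truncnS_gt.
have kM : (k <= M)%N.
  by rewrite -(ler_nat R) -(ler_pM2r dl0) Mdl; lra.
have kdl0 : 0 <= k%:R * dl by rewrite mulr_ge0// ltW.
have pk : f h * (k%:R * dl + h) <= prob_itv f (- (k%:R * dl)) h.
  by apply: le_trans _ (prob_itv_ge _ _ _) => //; lra.
have pk0 : 0 < prob_itv f (- (k%:R * dl)) h.
  by apply: lt_le_trans pk; rewrite mulr_gt0// ltr_wpDl.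
have dev : (1 - x) * prob_itv f (- (k%:R * dl)) h <=
    (\sum_(i < n) \1_(A (M - k)%N) (tnth X i)) / n%:R.
  rewrite leNgt; apply/negP => H; apply: XE; exists (M - k)%N; first exact: leq_subr.
  move: H; rewrite /A subKn// -/(prob_itv f _ _).
  move: (\sum_(i < n) _) => S; rewrite ltr_pdivrMr// => H.
  rewrite ler_normr; apply/orP; right.
  rewrite opprB lerBrDl -lerBrDr ler_pdivrMr//; nra.
move: dev; rewrite /A subKn// empirical_cdf_itv; last by lra.
have : empirical_cdf X s <= empirical_cdf X (- (k%:R * dl)).
  by apply: empirical_cdf_nondecreasing; lra.
have : f h * ((1 - x) * (h - s)) <= f h * (k%:R * dl + h).
  rewrite ler_pM2l//; nra.
nra.
Qed.

End grenander_tails.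

(** * Neighbouring densities *)

(** A decreasing function [u] that differs from the density [f] by at most [e], only
    on [s1, s2], and only where [u] is at least [b], becomes a density when divided
    by its integral Z.  The chi-square distance is taken with [u] in the
    denominator, since [u] is bounded below where it differs from [f]. *)
Section perturbed_density.
Context {R : realType} (f : decreasing_density R).
Local Notation mu := (@lebesgue_measure R).
Local Notation I := (`[(-1)%R, +oo[%classic : set R).

Implicit Types x y c : R.

Context (u : R -> R) (s1 s2 e b : R) (e0 : 0 <= e) (b0 : 0 < b).
Context (s12 : s1 <= s2) (es : e * (s2 - s1) <= 2^-1).
Let S := (`[s1, s2]%classic : set R).
Context (u_ge0 : forall x, -1 <= x -> 0 <= u x).
Context (u_decreasing : forall x y, -1 <= x -> x <= y -> u y <= u x).
Context (u_near : forall x, -1 <= x -> `|u x - f x| <= e * \1_S x).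
Context (u_ge : forall x, -1 <= x -> u x != f x -> b <= u x).

Let mI : measurable I := measurable_itv (Interval _ _).
Let mS : measurable S := measurable_itv (Interval _ _).

Let inI x : I x -> -1 <= x.
Proof. by rewrite /= in_itv/= andbT. Qed.

Let mu_ : measurable_fun I u.
Proof.
apply: (eq_measurable_fun (fun x : R => u (Num.max (-1) x))).
  by move=> x; rewrite inE/= in_itv/= andbT => /max_idPr ->.
apply: nonincreasing_measurable => // x y xy.
apply: u_decreasing; first by rewrite le_max lexx.
by rewrite ge_max le_max lexx/= le_max xy orbT.
Qed.

Let mf : measurable_fun I (f : R -> R).
Proof. exact: measurable_density. Qed.

Let int_S c : 0 <= c ->
  (\int[mu]_(x in I) (c * \1_S x)%:E <= (c * (s2 - s1))%:E)%E.
Proof.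
move=> c0; under eq_integral do rewrite EFinM.
rewrite ge0_integralZl//; last first.
  by apply/measurable_EFinP; apply: measurable_indic.
rewrite integral_indic// EFinM lee_wpmul2l// ?lee_fin//.
apply: (@le_trans _ _ (mu S)).
  by apply: le_measure; rewrite ?inE//; exact: measurableI.
rewrite lebesgue_measure_itv/= lte_fin; case: ifPn => _; first by rewrite -EFinB.
by rewrite lee_fin subr_ge0.
Qed.

Let mS_ c : measurable_fun I (fun x => (c * \1_S x)%:E).
Proof.
by apply/measurable_EFinP/measurable_funM => //; apply: measurable_indic.
Qed.

Let S_ge0 c x : 0 <= c -> (0 <= (c * \1_S x)%:E)%E.
Proof. by move=> c0; rewrite lee_fin mulr_ge0. Qed.

Let int_u_le : (\int[mu]_(x in I) (u x)%:E <= 1 + (e * (s2 - s1))%:E)%E.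
Proof.
apply: (@le_trans _ _ (\int[mu]_(x in I) ((f x)%:E + (e * \1_S x)%:E))%E).
  apply: ge0_le_integral => //.
  - by move=> x /inI x1; rewrite lee_fin u_ge0.
  - exact/measurable_EFinP.
  - by apply: emeasurable_funD; [exact/measurable_EFinP|exact: mS_].
  - move=> x /inI x1; rewrite -EFinD lee_fin.
    by have := u_near x1; rewrite ler_norml => /andP[_]; rewrite lerBlDl.
rewrite ge0_integralD//.
- by rewrite density_integral leeD2l// int_S.
- by move=> x /inI x1; rewrite lee_fin density_ge0.
- exact/measurable_EFinP.
- by move=> x _; exact: S_ge0.
- exact: mS_.
Qed.

Let int_u_ge : (1 <= \int[mu]_(x in I) (u x)%:E + (e * (s2 - s1))%:E)%E.
Proof.
rewrite -(density_integral f).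
apply: (@le_trans _ _ (\int[mu]_(x in I) ((u x)%:E + (e * \1_S x)%:E))%E).
  apply: ge0_le_integral => //.
  - by move=> x /inI x1; rewrite lee_fin density_ge0.
  - exact/measurable_EFinP.
  - by apply: emeasurable_funD; [exact/measurable_EFinP|exact: mS_].
  - move=> x /inI x1; rewrite -EFinD lee_fin.
    have := u_near x1; rewrite ler_norml => /andP[+ _].
    lra.
rewrite ge0_integralD//.
- by rewrite leeD2l// int_S.
- by move=> x /inI x1; rewrite lee_fin u_ge0.
- exact/measurable_EFinP.
- by move=> x _; exact: S_ge0.
- exact: mS_.
Qed.

Let Z : R := fine (\int[mu]_(x in I) (u x)%:E)%E.

Let int_u0 : (0 <= \int[mu]_(x in I) (u x)%:E)%E.
Proof. by apply: integral_ge0 => x /inI x1; rewrite lee_fin u_ge0. Qed.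

Let int_uE : (\int[mu]_(x in I) (u x)%:E = Z%:E)%E.
Proof.
by rewrite fineK// ge0_fin_numE// (le_lt_trans int_u_le)// -EFinD ltry.
Qed.

Let Z_near : `|Z - 1| <= e * (s2 - s1).
Proof.
have := int_u_ge; have := int_u_le; rewrite int_uE -!EFinD !lee_fin => H1 H2.
by rewrite ler_norml; apply/andP; split; lra.
Qed.

Let Z_gt0 : 0 < Z.
Proof. by have := Z_near; rewrite ler_norml => /andP[]; move: es; lra. Qed.

Let Z_le2 : Z <= 2.
Proof. by have := Z_near; rewrite ler_norml => /andP[]; move: es; lra. Qed.

Let v_ge0 x : -1 <= x -> 0 <= u x / Z.
Proof. by move=> x1; rewrite divr_ge0 ?u_ge0// ltW. Qed.

Let v_decreasing x y : -1 <= x -> x <= y -> u y / Z <= u x / Z.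
Proof. by move=> x1 xy; rewrite ler_pM2r ?invr_gt0// u_decreasing. Qed.

Let v_integral : (\int[mu]_(x in `[(-1)%R, +oo[) (u x / Z)%:E = 1)%E.
Proof.
under eq_integral do rewrite mulrC EFinM.
rewrite ge0_integralZl//.
- by rewrite int_uE -EFinM mulVf// lt0r_neq0.
- exact/measurable_EFinP.
- by move=> x /inI x1; rewrite lee_fin u_ge0.
- by rewrite lee_fin invr_ge0 ltW.
Qed.

Let v : decreasing_density R := DecreasingDensity v_ge0 v_decreasing v_integral.

Let u0_f0 x : -1 <= x -> u x = 0 -> f x = 0.
Proof.
move=> x1 ux; apply/eqP; apply: contraTT b0 => fx; rewrite -leNgt -ux.
by apply: u_ge => //; rewrite ux eq_sym.
Qed.

(* With d = u - f, one has f^2/u + u = 2 f + d^2/u, in which all the terms are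
   nonnegative: this avoids integrating the signed function d. *)
Let int_sq : (\int[mu]_(x in I) (f x ^+ 2 / u x)%:E + Z%:E <=
  (2 + e ^+ 2 / b * (s2 - s1))%:E)%E.
Proof.
have mfu : measurable_fun I (fun x => (f x ^+ 2 / u x)%:E : \bar R).
  apply/measurable_EFinP/measurable_funM; first exact: measurable_funX.
  apply: (eq_measurable_fun (fun x => u x `^ (-1))) => [x /[!inE] /inI x1|].
    by rewrite powR_inv1// u_ge0.
  exact: (measurableT_comp (measurable_powR (-1)) mu_).
have fu0 x : I x -> (0 <= (f x ^+ 2 / u x)%:E)%E.
  by move=> /inI x1; rewrite lee_fin divr_ge0 ?sqr_ge0 ?u_ge0.
have eb0 : 0 <= e ^+ 2 / b by rewrite divr_ge0 ?sqr_ge0 ?ltW.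
have f0 x : I x -> (0 <= (f x)%:E)%E.
  by move=> /inI x1; rewrite lee_fin density_ge0.
have u0 x : I x -> (0 <= (u x)%:E)%E.
  by move=> /inI x1; rewrite lee_fin u_ge0.
have mu1 : measurable_fun I (fun x => (u x)%:E) by exact/measurable_EFinP.
have mf1 : measurable_fun I (fun x => (f x)%:E) by exact/measurable_EFinP.
rewrite -int_uE -ge0_integralD//.
apply: (@le_trans _ _ (\int[mu]_(x in I) (((f x)%:E + (f x)%:E) +
    (e ^+ 2 / b * \1_S x)%:E))%E).
  apply: ge0_le_integral => //.
  - by move=> x Ix; rewrite adde_ge0 ?fu0 ?u0.
  - exact: emeasurable_funD.
  - by apply: emeasurable_funD; [exact: emeasurable_funD|exact: mS_].
  - move=> x /inI x1; rewrite -!EFinD lee_fin.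
    have [ux|ux] := eqVneq (u x) 0.
      by rewrite ux u0_f0// expr0n/= mul0r !addr0 add0r mulr_ge0.
    have up : 0 < u x by rewrite lt_neqAle eq_sym ux u_ge0.
    have -> : f x ^+ 2 / u x + u x = f x + f x + (u x - f x) ^+ 2 / u x by field.
    rewrite lerD2l; have [->|uf] := eqVneq (u x) (f x).
      by rewrite subrr expr0n/= mul0r mulr_ge0.
    have bu := u_ge x1 uf.
    have : (u x - f x) ^+ 2 <= (e * \1_S x) ^+ 2.
      rewrite -[leLHS]real_normK ?num_real// ler_pXn2r// ?nnegrE ?mulr_ge0//.
      exact: u_near.
    rewrite exprMn indicE; case: (x \in S); rewrite /= ?expr1n ?expr0n/= ?mulr1 ?mulr0 => H.
      rewrite ler_pdivrMr//; apply: (le_trans H).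
      by rewrite -mulrA ler_peMr ?sqr_ge0// mulrC ler_pdivlMr// mul1r.
    by rewrite pmulr_lle0 ?invr_gt0.
rewrite ge0_integralD//; last 3 first.
- exact: emeasurable_funD.
- by move=> x _; exact: S_ge0.
- exact: mS_.
rewrite ge0_integralD// density_integral [leRHS]EFinD.
  by apply: leeD => //; exact: int_S.
by move=> x Ix; rewrite adde_ge0// f0.
Qed.

(** The second moment is Z times the integral of f^2/u, hence at most
    Z (2 + V - Z) = 1 - (Z - 1)^2 + Z V, which is second order in [e]: the first
    order effect of the renormalization cancels. *)
Lemma perturbed_density : exists v : decreasing_density R, exists Z : R,
  [/\ 0 < Z <= 2, `|Z - 1| <= e * (s2 - s1), v 0 = u 0 / Z &
  second_moment_dominated (density_law f) (density_law v)
    (1 + 2 * (e ^+ 2 * (s2 - s1) / b))].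
Proof.
exists v, Z; split => //; first by rewrite Z_gt0.
have V0 : 0 <= e ^+ 2 * (s2 - s1) / b.
  by rewrite divr_ge0 ?mulr_ge0 ?sqr_ge0 ?subr_ge0// ltW.
apply: second_moment_dominated_density; first lra.
  move=> x x1 /= /eqP; rewrite mulf_eq0 invr_eq0 (gt_eqF Z_gt0) orbF => /eqP.
  exact: u0_f0.
under eq_integral do rewrite /= invf_div mulrA mulrAC mulrC EFinM.
have fu0 x : I x -> (0 <= (f x ^+ 2 / u x)%:E)%E.
  by move=> /inI x1; rewrite lee_fin divr_ge0 ?sqr_ge0 ?u_ge0.
rewrite ge0_integralZl//; last 2 first.
- apply/measurable_EFinP/measurable_funM; first exact: measurable_funX.
  apply: (eq_measurable_fun (fun x => u x `^ (-1))) => [x /[!inE] /inI x1|].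
    by rewrite powR_inv1// u_ge0.
  exact: (measurableT_comp (measurable_powR (-1)) mu_).
- by rewrite lee_fin ltW.
have : (0 <= \int[mu]_(x in I) (f x ^+ 2 / u x)%:E)%E by exact: integral_ge0.
move: int_sq; case: (\int[mu]_(x in I) (f x ^+ 2 / u x)%:E)%E => [w| |]//=.
rewrite -EFinD -EFinM !lee_fin mulrAC => H w0.
set V := e ^+ 2 * (s2 - s1) / b in V0 H *.
have : Z * (w + Z) <= Z * (2 + V) by rewrite ler_pM2l.
have : Z * V <= 2 * V by rewrite ler_wpM2r.
have := sqr_ge0 (Z - 1).
nra.
Qed.

End perturbed_density.

Section alternatives.
Context {R : realType} (f : decreasing_density R).

(** Since Z differs from 1 by at most [e], dividing by Z undoes at most the fraction
    [f 0 < 1] of the perturbation, up to the factor Z. *)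
Lemma separation (Z u0 e l : R) : 0 <= f 0 < 1 -> 0 < e -> 0 <= l <= 1 -> 0 < Z <= 2 ->
  `|Z - 1| <= e * l -> u0 = f 0 + e \/ u0 = f 0 - e ->
  (1 - f 0) * e / 2 <= `|u0 / Z - f 0|.
Proof.
move=> /andP[a0 a1] e0 /andP[l0 l1] /andP[Z0 Z2]; rewrite ler_norml => /andP[Zl Zu] u0E.
have fe0 : 0 <= (1 - f 0) * e by rewrite mulr_ge0 ?ltW// subr_gt0.
have el : e * l <= e by rewrite ler_piMr// ltW.
rewrite ler_normr; case: u0E => ->; apply/orP; [left|right].
  rewrite lerBrDl ler_pdivlMr//; nra.
rewrite opprB lerBrDr -lerBrDl ler_pdivrMr//; nra.
Qed.

(** The density is raised to [f 0 + e] on [-1, 0]; this changes nothing to the left of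
    [- l] if [f (- l)] is already that large. *)
Lemma upward_alternative (e l : R) : 0 < e -> 0 < l <= 1 -> 0 <= f 0 < 1 ->
  e * l <= 2^-1 -> l = 1 \/ f 0 + e <= f (- l) ->
  exists2 v : decreasing_density R, (1 - f 0) * e / 2 <= `|v 0 - f 0| &
    second_moment_dominated (density_law f) (density_law v)
      (1 + 2 * (e ^+ 2 * l / (f 0 + e))).
Proof.
move=> e0 /andP[l0 l1] f01 el lf; have /andP[f00 f0lt1] := f01.
pose u x := if x <= 0 then Num.max (f x) (f 0 + e) else f x.
have f_ge x : -1 <= x <= 0 -> f 0 <= f x.
  by move=> /andP[x1 x0]; apply: density_decreasing.
have [] := @perturbed_density R f u (- l) 0 e (f 0 + e); rewrite ?sub0r ?opprK//.
- exact: ltW.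
- lra.
- lra.
- move=> x x1; rewrite /u; case: ifP => _; last exact: density_ge0.
  by rewrite le_max density_ge0.
- move=> x y x1 xy; rewrite /u.
  have fyx : f y <= f x by exact: density_decreasing.
  have [y0|y0] := leP y 0.
    by rewrite (le_trans xy y0) ge_max !le_max fyx lexx orbT.
  by case: ifP => _ //; rewrite le_max fyx.
- move=> x x1; rewrite /u indicE mem_setE in_itv/=.
  case: ifPn => x0; last by rewrite subrr normr0 mulr_ge0// ltW.
  have fx : f 0 <= f x by rewrite f_ge// x1.
  rewrite andbT.
  have [lx|xl] := leP (- l) x; rewrite ?mulr1 ?mulr0/=.
    case: (leP (f x) (f 0 + e)) => H; last by rewrite subrr normr0 ltW.
    by rewrite ger0_norm; lra.
  suff -> : Num.max (f x) (f 0 + e) = f x by rewrite subrr normr0.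
  case: lf => [l1E|lf]; first by exfalso; move: xl x1; rewrite l1E; lra.
  by apply/max_idPl; apply: (le_trans lf); apply: density_decreasing => //; exact: ltW.
- move=> x x1; rewrite /u; case: ifP => _; last by rewrite eqxx.
  by move=> _; rewrite le_max lexx orbT.
move=> v [Z [Z02 Zl v0 dom]]; exists v => //.
rewrite v0 /u lexx (max_idPr _); last by lra.
by apply: (@separation Z _ e l) => //; [lra|left].
Qed.

(** The density is cut at [f 0 - e] on the right of 0; it is already below that level
    beyond [l]. *)
Lemma downward_alternative (e l : R) : 0 < e < f 0 -> 0 < l <= 1 -> f 0 < 1 ->
  e * l <= 2^-1 -> f l <= f 0 - e ->
  exists2 v : decreasing_density R, (1 - f 0) * e / 2 <= `|v 0 - f 0| &
    second_moment_dominated (density_law f) (density_law v)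
      (1 + 2 * (e ^+ 2 * l / (f 0 - e))).
Proof.
move=> /andP[e0 ef] /andP[l0 l1] f01 el lf.
pose u x := if x < 0 then f x else Num.min (f x) (f 0 - e).
have f_le x : 0 <= x -> f x <= f 0.
  by move=> x0; apply: density_decreasing.
have [] := @perturbed_density R f u 0 l e (f 0 - e); rewrite ?subr0//.
- exact: ltW.
- lra.
- exact: ltW.
- move=> x x1; rewrite /u; case: ifP => _; first exact: density_ge0.
  by rewrite le_min density_ge0//; lra.
- move=> x y x1 xy; rewrite /u.
  have fyx : f y <= f x by exact: density_decreasing.
  have [x0|x0] := ltP x 0.
    by case: ifP => _ //; rewrite ge_min fyx.
  by rewrite ltNge (le_trans x0 xy)/= le_min !ge_min fyx lexx orbT.
- move=> x x1; rewrite /u indicE mem_setE in_itv/=.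
  have [x0|x0] := ltP x 0; first by rewrite subrr normr0 mulr_ge0// ltW.
  have fx := f_le _ x0.
  have [xl|lx] := leP x l; rewrite ?mulr1 ?mulr0/=.
    case: (leP (f x) (f 0 - e)) => H; first by rewrite subrr normr0 ltW.
    by rewrite ler0_norm; lra.
  suff -> : Num.min (f x) (f 0 - e) = f x by rewrite subrr normr0.
  apply/min_idPl; apply: le_trans lf; apply: density_decreasing; lra.
- move=> x x1; rewrite /u; case: ifP => _; first by rewrite eqxx.
  by case: (leP (f x) (f 0 - e)) => // _; rewrite eqxx.
move=> v [Z [Z02 Zl v0 dom]]; exists v => //.
rewrite v0 /u ltxx (min_idPr _); last by lra.
by apply: (@separation Z _ e l) => //; [lra|lra|right].
Qed.

End alternatives.

(** * The rate at a given density *)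

Section two_points.
Context {R : realType}.

Lemma product_budget (eps : R) : 0 < eps -> exists2 c : R, 0 < c &
  forall n V, 0 <= V -> n%:R * V <= c -> (1 + V) ^+ n <= 1 + eps ^+ 2 / 4.
Proof.
move=> e0; have e20 : 0 < eps ^+ 2 / 4 by rewrite divr_gt0// exprn_gt0.
exists (ln (1 + eps ^+ 2 / 4)); first by rewrite ln_gt0// ltrDl.
move=> n V V0 nV.
rewrite -[leRHS]lnK; last by rewrite posrE addr_gt0.
apply: le_trans (_ : expR (n%:R * V) <= _); last by rewrite ler_expR.
rewrite expRM_natl; apply: lerXn2r; rewrite ?nnegrE ?expR_ge0 ?addr_ge0//.
exact: expR_ge1Dx.
Qed.

Definition indistinguishable (f v : decreasing_density R) n (eps : R) :=
  forall A : set (n.-tuple R), measurable A ->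
  (iid_law (density_law f) n A <= iid_law (density_law v) n A + eps%:E)%E /\
  (iid_law (density_law v) n A <= iid_law (density_law f) n A + eps%:E)%E.

Lemma indistinguishable_budget (eps : R) : 0 < eps <= 1 -> exists2 c : R, 0 < c &
  forall (f v : decreasing_density R) n V, 0 <= V -> n%:R * V <= c ->
  second_moment_dominated (density_law f) (density_law v) (1 + V) ->
  indistinguishable f v n eps.
Proof.
move=> eps01; have /andP[e0 _] := eps01.
have [c c0 budget] := product_budget e0; exists c => // f v n V V0 nV dom A mA.
apply: (second_moment_total_variation eps01 (budget n V V0 nV)) => //.
by apply: second_moment_dominated_iid => //; rewrite addr_ge0.
Qed.

(** The mass on [-1, 0] is at least [f 0], and by continuity some mass remains on
    the right of 0 unless [f 0 = 0]. *)
Lemma density_at0_lt1 (f : decreasing_density R) :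
  {for 0, continuous (f : R -> R)} -> 0 <= f 0 < 1.
Proof.
move=> fc; have f00 : 0 <= f 0 by apply: density_ge0; lra.
rewrite f00/= ltNge; apply/negP => f01.
have : \forall y \near (0 : R), f 0 / 2 < f y.
  by apply: (cvgr_gt (f 0) fc); lra.
move=> /nbhs_ballP[d /= d0 fd].
have d20 : 0 < d / 2 by rewrite divr_gt0.
have fd2 : f 0 / 2 < f (d / 2).
  by apply: fd; rewrite /ball/= sub0r normrN gtr0_norm//; lra.
have := prob_itv_le1 f (-1) (d / 2).
rewrite (@prob_itvD _ f _ 0); [|lra|lra].
have p1 : f 0 * (0 - -1) <= prob_itv f (-1) 0 by apply: prob_itv_ge; lra.
have p2 : f (d / 2) * (d / 2 - 0) <= prob_itv f 0 (d / 2) by apply: prob_itv_ge; lra.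
nra.
Qed.

Lemma density_law_nonpositive (f : decreasing_density R) : f 0 = 0 ->
  density_law f `]-oo, 0]%classic = 1%E.
Proof.
move=> f00; have mN : measurable (`]0, +oo[%classic : set R) by exact: measurable_itv.
have -> : `]-oo, 0]%classic = ~` `]0, +oo[%classic :> set R.
  by apply/seteqP; split => x /=; rewrite !in_itv/= andbT => H;
    [by apply/negP; rewrite -leNgt|by rewrite leNgt; apply/negP].
rewrite probability_setC// [X in (1 - X)%E](_ : _ = 0%E) ?sube0//.
apply: integral0_eq => x /= []; rewrite !in_itv/= !andbT => x0 x1.
by congr EFin; apply/eqP; rewrite eq_le density_ge0// andbT -f00 density_decreasing// ?ltW//; lra.
Qed.

(** The constants are chosen before [n]: they say that the rate [r] attained by the
    estimator under [f] is, up to a constant factor, also unavoidable. *)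
Definition matched_rate (f : decreasing_density R) (alpha eps : R) :=
  exists C kap : R, [/\ 0 < C, 0 < kap & forall n, (0 < n)%N ->
  exists r : R, exists v : decreasing_density R, [/\ 0 < r,
    exists E : set (n.-tuple R), [/\ measurable E,
      (iid_law (density_law f) n E <= alpha%:E)%E &
      forall X, ~ E X -> `|grenander X 0 - f 0| < C * r],
    kap * r <= `|v 0 - f 0| & indistinguishable f v n eps]].

(** All the observations are nonpositive under [f], so the estimator vanishes almost
    surely.  The neighbour has a value of order [c / n] at 0; its second moment
    bound is linear in this height, because the raised level is also the lower
    bound of the perturbed density where it was changed. *)
Lemma matched_rate_eq0 (f : decreasing_density R) (alpha eps : R) :
  0 < alpha -> 0 < eps <= 1 -> f 0 = 0 -> matched_rate f alpha eps.
Proof.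
move=> al0 eps01 f00; have [c0 c00 budget] := indistinguishable_budget eps01.
pose c := Num.min (2^-1) (c0 / 2).
have c_gt0 : 0 < c by rewrite lt_min; apply/andP; split; lra.
have c_le : c <= 2^-1 by rewrite ge_min lexx.
have c_le' : c <= c0 / 2 by rewrite ge_min lexx orbT.
exists 1, (c / 2); split=> [//||n n0]; first by rewrite divr_gt0.
have nR : 0 < n%:R :> R by rewrite ltr0n.
have nV : n%:R^-1 <= 1 :> R by rewrite invf_le1// ler1n.
have e0 : 0 < c / n%:R by rewrite divr_gt0.
have e1 : c / n%:R * 1 <= 2^-1 by rewrite mulr1; nra.
have l01 : 0 < (1 : R) <= 1 by rewrite ltr01 lexx.
have f01 : 0 <= f 0 < 1 by rewrite f00 lexx ltr01.
have [v v0 dom] := upward_alternative e0 l01 f01 e1 (or_introl erefl).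
exists n%:R^-1, v; split.
- by rewrite invr_gt0.
- pose N := [set X : n.-tuple R | forall i, (`]-oo, 0]%classic : set R) (tnth X i)].
  have mN : measurable N.
    rewrite [X in measurable X](_ : _ =
      \bigcap_(i : 'I_n) ((fun X : n.-tuple R => tnth X i) @^-1` `]-oo, 0]%classic)).
      apply: fin_bigcap_measurable => // i _.
      by rewrite -[X in measurable X]setTI; apply: measurable_tnth => //; exact: measurable_itv.
    by apply/seteqP; split => /= X XA i => [_|]; apply: XA.
  exists (~` N); split.
  + exact: measurableC.
  + rewrite probability_setC//.
    rewrite [X in (1 - X)%E](_ : _ = 1%E) ?subee ?lee_fin ?ltW//.
    apply: etrans (@iid_law_rectangle _ _ _ (density_law f) n (fun=> `]-oo, 0]%classic) _) _ => //.
    by apply: big1 => i _; exact: density_law_nonpositive.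
  + move=> X /contrapT/= XN; rewrite f00 subr0 mul1r.
    suff -> : grenander X 0 = 0 by rewrite normr0 invr_gt0.
    apply/eqP; rewrite eq_le grenander_ge0 andbT.
    apply: (@grenander_le _ _ _ _ 0) => [|t t0]; first lra.
    rewrite mul0r subr_le0 /empirical_cdf ler_wpM2r ?invr_ge0// ler_sum// => i _.
    by have := XN i; rewrite /= in_itv/= => ->; rewrite ler_nat leq_b1.
- by move: v0; rewrite f00 subr0 mul1r; congr (_ <= _); rewrite mulrAC.
- apply: budget dom; first by rewrite f00 add0r mulr1; apply: mulr_ge0 => //; rewrite divr_ge0 ?sqr_ge0 ?ltW.
  rewrite f00 add0r mulr1 expr2 mulfK ?gt_eqF//.
  rewrite mulrCA [n%:R * _]mulrC divfK ?gt_eqF//; lra.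
Qed.

(** The oscillation of [f] over the window, which bounds the bias, is at most the
    stochastic error [r] = (n h)^(-1/2).  The bound on [r] makes the
    constants that follow uniform in [n]. *)
Definition balanced_window (f : decreasing_density R) n (h r : R) :=
  [/\ 0 < h <= 1, 0 < r <= 1 + 2 * f (-1), n%:R * h * r ^+ 2 = 1 &
    f (- h) - f h <= r].

(** The least k for which h = 2^(-k) is balanced.  If k > 0, the window twice as
    large is unbalanced, and its [r] is smaller by the factor sqrt 2, hence still
    above r / 2. *)
Lemma balanced_window_exists (f : decreasing_density R) n : (0 < n)%N ->
  exists h r : R, balanced_window f n h r /\
    (h = 1 \/ 2 * h <= 1 /\ r / 2 < f (- (2 * h)) - f (2 * h)).
Proof.
move=> n0; have nR : 0 < n%:R :> R by rewrite ltr0n.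
have f1 : 0 <= f (-1) by apply: density_ge0.
pose hh k : R := (2 ^+ k)^-1.
pose rr k : R := Num.sqrt (2 ^+ k / n%:R).
have hh0 k : 0 < hh k by rewrite invr_gt0 exprn_gt0.
have hh1 k : hh k <= 1 by rewrite invf_le1 ?exprn_ege1 ?exprn_gt0// ler1n.
have rr0 k : 0 < rr k by rewrite sqrtr_gt0 divr_gt0// exprn_gt0.
have rr2 k : n%:R * hh k * rr k ^+ 2 = 1.
  rewrite sqr_sqrtr; last by rewrite divr_ge0// ltW.
  by rewrite /hh; field; rewrite lt0r_neq0//= expf_neq0.
have hhS k : hh k = 2 * hh k.+1 by rewrite /hh exprS; field; rewrite expf_neq0.
have p2n k : 0 <= 2 ^+ k / n%:R :> R by rewrite divr_ge0// exprn_ge0.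
have rrS k : rr k.+1 <= 2 * rr k.
  rewrite -(ler_pXn2r (n := 2))// ?nnegrE ?mulr_ge0 ?sqrtr_ge0// exprMn.
  rewrite !sqr_sqrtr//; have := p2n k.
  by rewrite exprS -mulrA; move: (2 ^+ k / n%:R) => y; lra.
have osc_le k : f (- hh k) - f (hh k) <= f (-1).
  have := hh1 k; have := hh0 k; move: (hh k) => h h0 h1.
  have : f (- h) <= f (-1) by apply: density_decreasing; lra.
  have : 0 <= f h by apply: density_ge0; lra.
  lra.
pose good k := f (- hh k) - f (hh k) <= rr k.
have ex_good : exists k, good k.
  pose k := (Num.truncn (n%:R * f (-1) ^+ 2)).+1; exists k.
  apply: (le_trans (osc_le k)); rewrite /rr -[leLHS]ger0_norm//.
  rewrite -sqrtr_sqr ler_wsqrtr// ler_pdivlMr// mulrC.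
  apply: le_trans (ltW (truncnS_gt _)) _; rewrite -natrX ler_nat.
  by apply: ltnW; apply: ltn_expl.
case: (ex_minnP ex_good) => k kgood kmin.
exists (hh k), (rr k).
have [k0|kgt0] := posnP k.
  split; last by left; rewrite /hh k0 expr0 invr1.
  split=> //; rewrite ?hh0 ?hh1// rr0 /rr k0 expr0 div1r.
  apply: (@le_trans _ _ 1); last by rewrite lerDl mulr_ge0.
  by rewrite -[leRHS]sqrtr1 ler_wsqrtr// invf_le1// ler1n.
have bad : rr k.-1 < f (- hh k.-1) - f (hh k.-1).
  by rewrite ltNge; apply/negP => /kmin; rewrite leqNgt prednK// leqnn.
have h2 : 2 * hh k = hh k.-1 by rewrite (hhS k.-1) prednK.
have rk := rrS k.-1; rewrite prednK// in rk.
have ok := osc_le k.-1.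
split; last by right; rewrite h2; split; [exact: hh1|lra].
split=> //; first by rewrite hh0 hh1.
rewrite rr0/=; lra.
Qed.

(** The tail bounds with x = x0 r: the probabilities are of order 1/(a x0^2), small
    when x0 is large, and the thresholds differ from [f 0] by O(r).  When r is not
    small compared with [f 0], the lower tail bound gives nothing and the trivial
    bound, that the slope is nonnegative, suffices. *)
Lemma grenander_concentration (f : decreasing_density R) (alpha : R) :
  0 < f 0 -> 0 < alpha ->
  exists2 C : R, 0 < C & forall n h r, (0 < n)%N -> balanced_window f n h r ->
  exists E : set (n.-tuple R), [/\ measurable E,
    (iid_law (density_law f) n E <= alpha%:E)%E &
    forall X, ~ E X -> `|grenander X 0 - f 0| < C * r].
Proof.
move fa : (f 0) => a a0 al0.
have f1a : a <= f (-1) by rewrite -fa; apply: density_decreasing.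
pose B := 1 + 2 * f (-1).
have B0 : 0 < B by rewrite /B; lra.
pose x0 := 1 + 4 / (a * alpha).
have aal : 0 < a * alpha by rewrite mulr_gt0.
have x01 : 1 <= x0 by rewrite lerDl divr_ge0// ltW.
have x00 : 0 < x0 by lra.
have x20 : 0 < x0 ^+ 2 by rewrite exprn_gt0.
have ax : 0 < a * x0 ^+ 2 by rewrite mulr_gt0.
have x0P : 4 / (a * x0 ^+ 2) <= alpha.
  rewrite ler_pdivrMr// mulrCA mulrA.
  have : (a * alpha) * x0 = a * alpha + 4 by rewrite /x0; field; rewrite !lt0r_neq0.
  have : (a * alpha) * x0 <= (a * alpha) * x0 ^+ 2 by rewrite ler_pM2l// expr2 ler_peMr// ltW.
  lra.
pose q := 2 * x0 + x0 ^+ 2 * B.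
have q0 : 0 <= q by rewrite addr_ge0// mulr_ge0 ?sqr_ge0// ltW.
have qaB : 0 <= q * (a + B) by rewrite mulr_ge0// addr_ge0// ltW.
have x0a : 0 <= 2 * x0 * a by rewrite !mulr_ge0// ltW.
pose C := 3 + 2 * x0 * a + q * (a + B).
exists C; first by rewrite /C; lra.
move=> n h r n0 [/andP[h0 h1] /andP[r0 rB] nhr osc].
have nR : 0 < n%:R :> R by rewrite ltr0n.
have fhl : a <= f (- h) by rewrite -fa; apply: density_decreasing; lra.
have fhr : f h <= a by rewrite -fa; apply: density_decreasing; lra.
have xr0 : 0 < x0 * r by rewrite mulr_gt0.
have C3 : 3 * r <= C * r by rewrite ler_pM2r// /C; lra.
have tail_bound b : a / 2 <= b ->
    (n%:R * (b * h) * (x0 * r) ^+ 2)^-1 <= 2 / (a * x0 ^+ 2).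
  move=> ab; have -> : n%:R * (b * h) * (x0 * r) ^+ 2 = b * x0 ^+ 2.
    by rewrite -[RHS]mulr1 -[X in _ = _ * X]nhr; ring.
  have b0 : 0 < b by lra.
  rewrite -[leRHS]invf_div lef_pV2 ?posrE; first by rewrite mulrAC ler_pM2r.
    by rewrite mulr_gt0.
  by rewrite divr_gt0.
have [E1 [mE1 PE1 E1P]] : exists E : set (n.-tuple R), [/\ measurable E,
    (iid_law (density_law f) n E <= (2 / (a * x0 ^+ 2))%:E)%E &
    forall X, ~ E X -> grenander X 0 - a < C * r].
  have fgt0 : 0 < f 0 by rewrite fa.
  have [E [mE PE EP]] := grenander_upper_tail n0 (introT andP (conj h0 h1)) xr0 fgt0.
  exists E; split=> //.
    apply: (le_trans PE); rewrite lee_fin; apply: tail_bound; rewrite fa; lra.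
  move=> X /EP /le_lt_trans - up; rewrite ltrBlDr; apply: up.
  apply: (@le_lt_trans _ _ ((1 + x0 * r) ^+ 2 * (a + r))).
    by rewrite ler_wpM2l ?sqr_ge0//; lra.
  have -> : (1 + x0 * r) ^+ 2 * (a + r) =
    a + (1 + (2 * x0 + x0 ^+ 2 * r) * (a + r)) * r by ring.
  rewrite addrC ltrD2r ltr_pM2r// /C.
  have : (2 * x0 + x0 ^+ 2 * r) * (a + r) <= q * (a + B).
    apply: ler_pM; rewrite ?lerD2l//.
    - by rewrite addr_ge0// mulr_ge0 ?sqr_ge0// ltW.
    - by rewrite addr_ge0// ltW.
    - by rewrite ler_wpM2l ?sqr_ge0.
  lra.
have [/andP[ra xr1]|] := boolP ((r <= a / 2) && (x0 * r <= 1)); last first.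
  rewrite negb_and -!ltNge => bad.
  have aC : a < C * r.
    case/orP: bad => bad; first by lra.
    have : 2 * x0 * a * r <= C * r by rewrite ler_pM2r// /C; lra.
    have : a * 1 < a * (x0 * r) by rewrite ltr_pM2l.
    lra.
  exists E1; split=> //.
    apply: (le_trans PE1); rewrite lee_fin; apply: le_trans x0P.
    by rewrite ler_pM2r ?invr_gt0// ler_nat.
  move=> X /E1P up; have g0 := grenander_ge0 X; rewrite ltr_norml up andbT; lra.
have fh0 : 0 < f h by lra.
have [E2 [mE2 PE2 E2P]] := grenander_lower_tail n0 h0 (introT andP (conj xr0 xr1)) fh0.
have {}PE2 : (iid_law (density_law f) n E2 <= (2 / (a * x0 ^+ 2))%:E)%E.
  by apply: (le_trans PE2); rewrite lee_fin; apply: tail_bound; lra.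
exists (E1 `|` E2); split.
- exact: measurableU.
- apply: le_trans (measureU2 _ mE1 mE2) _; apply: le_trans (leeD PE1 PE2) _.
  by rewrite -EFinD lee_fin -mulrDl -natrD.
- move=> X /not_orP[/E1P up /E2P low]; rewrite ltr_norml up andbT.
  have ar : 0 <= a - r by lra.
  have far : (1 - x0 * r) ^+ 2 * (a - r) <= (1 - x0 * r) ^+ 2 * f h.
    by rewrite ler_wpM2l ?sqr_ge0//; lra.
  have sq : 0 <= (x0 * r) ^+ 2 * (a - r) by rewrite mulr_ge0 ?sqr_ge0.
  have xrr : 0 <= (x0 * r) * r by rewrite mulr_ge0// ltW.
  have CR : (1 + 2 * x0 * a) * r < C * r by rewrite ltr_pM2r// /C; lra.
  by move: (C * r) CR far sq xrr low => y; clear; lra.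
Qed.

(** The perturbation has height e = c r.  The constant [c] keeps e below a / 4 and
    1 / 4, so that the perturbed density is of order [a] where it was changed,
    and below r / 4, so that the jump of size r / 2 across the unbalanced window leaves
    room for it on one of the two sides; the last constraint is the budget for
    the second moment. *)
Lemma alternative_at_window (f : decreasing_density R) (eps : R) :
  0 < eps <= 1 -> 0 < f 0 < 1 ->
  exists2 kap : R, 0 < kap & forall n h r, (0 < n)%N -> balanced_window f n h r ->
  (h = 1 \/ 2 * h <= 1 /\ r / 2 < f (- (2 * h)) - f (2 * h)) ->
  exists2 v : decreasing_density R, kap * r <= `|v 0 - f 0| &
    indistinguishable f v n eps.
Proof.
move=> eps01; move fa : (f 0) => a /andP[a0 a1].
have [c0 c00 budget] := indistinguishable_budget eps01.
have f1a : a <= f (-1) by rewrite -fa; apply: density_decreasing.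
pose B := 1 + 2 * f (-1).
have B1 : 1 <= B by rewrite /B; lra.
have B0 : 0 < B by lra.
pose c := Num.min (4^-1 / B) (Num.min (a / (4 * B)) (a * c0 / 8)).
have c_gt0 : 0 < c.
  by rewrite !lt_min !divr_gt0 ?mulr_gt0 ?invr_gt0.
have [cB1 cBa cc0] : [/\ c * B <= 4^-1, c * B <= a / 4 & c <= a * c0 / 8].
  have : c <= c by [].
  rewrite {2}/c !le_min => /and3P[c1 c2 c3]; split=> //.
    by rewrite -ler_pdivlMr.
  by rewrite -ler_pdivlMr// -mulrA -invfM.
have c14 : c <= 4^-1 by apply: le_trans cB1; rewrite ler_peMr// ltW.
exists ((1 - a) * c / 2) => [|n h r n0 [/andP[h0 h1] /andP[r0 rB] nhr _] wide].
  by rewrite divr_gt0// mulr_gt0// subr_gt0.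
have nR : 0 < n%:R :> R by rewrite ltr0n.
have cr0 : 0 < c * r by rewrite mulr_gt0.
have crB : c * r <= c * B by rewrite ler_pM2l.
have cr4 : c * r <= 4^-1 * r by rewrite ler_pM2r.
have acc : c * c <= 4^-1 * (a * c0 / 8) by rewrite ler_pM// ltW.
clearbody c B.
have a01 : 0 <= f 0 < 1 by rewrite fa a1 ltW.
have small l : 0 < l <= 1 -> c * r * l <= 2^-1.
  move=> /andP[l0 l1].
  have : c * r * l <= c * r by rewrite ler_piMr// ltW.
  by lra.
have close v l b : 0 < l -> l <= 2 * h -> a / 2 <= b ->
    second_moment_dominated (density_law f) (density_law v)
      (1 + 2 * ((c * r) ^+ 2 * l / b)) -> indistinguishable f v n eps.
  move=> l0 lh ab; have b0 : 0 < b by clear -ab a0; lra.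
  apply: budget; first by rewrite mulr_ge0// divr_ge0 ?mulr_ge0 ?sqr_ge0// ltW.
  have -> : n%:R * (2 * ((c * r) ^+ 2 * l / b)) = n%:R * 2 * (c * r) ^+ 2 * l / b.
    by ring.
  rewrite ler_pdivrMr//.
  apply: (@le_trans _ _ (n%:R * 2 * (c * r) ^+ 2 * (2 * h))).
    by rewrite ler_wpM2l// mulr_ge0 ?sqr_ge0// mulr_ge0.
  have -> : n%:R * 2 * (c * r) ^+ 2 * (2 * h) = 4 * (c * c).
    by rewrite -[RHS]mulr1 -[X in _ = _ * X]nhr; ring.
  have : c0 * (a / 2) <= c0 * b by rewrite ler_pM2l.
  have : 0 < a * c0 by rewrite mulr_gt0.
  by move: acc; clear; move: (c * c) => y; lra.
have up l : 0 < l <= 1 -> l <= 2 * h -> l = 1 \/ f 0 + c * r <= f (- l) ->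
    exists2 v : decreasing_density R,
    (1 - a) * c / 2 * r <= `|v 0 - a| & indistinguishable f v n eps.
  move=> l01 lh fl; have /andP[l0 l1] := l01.
  have [v vsep dom] := upward_alternative cr0 l01 a01 (small _ l01) fl.
  exists v; first by move: vsep; rewrite fa; congr (_ <= _); ring.
  by apply: close dom => //; rewrite fa; clear -a0 cr0; lra.
case: wide => [hE|[h2 wide]].
  by apply: (up 1) => //; [rewrite ltr01 lexx|rewrite hE mulr1 ler1n|left].
have l01 : 0 < 2 * h <= 1 by rewrite h2 mulr_gt0.
have [left_jump|right_jump] := leP (f 0 + c * r) (f (- (2 * h))).
  by apply: (up (2 * h)) => //; right.
have fl : f (2 * h) <= f 0 - c * r.
  by move: right_jump wide cr4; clear; lra.
have cra : 0 < c * r < f 0.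
  by rewrite cr0/= fa; move: crB cBa a0; clear; lra.
have f01 : f 0 < 1 by rewrite fa.
have [v vsep dom] := downward_alternative cra l01 f01 (small _ l01) fl.
exists v; first by move: vsep; rewrite fa; congr (_ <= _); ring.
apply: close dom => //; first by case/andP: l01.
by rewrite fa; move: crB cBa a0; clear; lra.
Qed.

Lemma matched_rate_gt0 (f : decreasing_density R) (alpha eps : R) :
  0 < alpha -> 0 < eps <= 1 -> 0 < f 0 < 1 -> matched_rate f alpha eps.
Proof.
move=> al0 eps01 f01; have /andP[f0 _] := f01.
have [C C0 conc] := grenander_concentration f0 al0.
have [kap kap0 alt] := alternative_at_window eps01 f01.
exists C, kap; split=> // n n0.
have [h [r [win wide]]] := balanced_window_exists f n0.
have [v vsep vind] := alt n h r n0 win wide.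
exists r, v; split=> //; first by case: win => _ /andP[].
exact: conc win.
Qed.

Lemma matched_rate_exists (f : decreasing_density R) (alpha eps : R) :
  {for 0, continuous (f : R -> R)} -> 0 < alpha -> 0 < eps <= 1 ->
  matched_rate f alpha eps.
Proof.
move=> /density_at0_lt1/andP[f0 f1] al0 eps01.
have [f00|fn0] := eqVneq (f 0) 0; first exact: matched_rate_eq0.
by apply: matched_rate_gt0 => //; rewrite lt_neqAle eq_sym fn0 f0.
Qed.

End two_points.

(** * Minimax lower bound and conclusion *)

Section limits.
Context {R : realType}.

Lemma limn_esup_le_eventually (u : (\bar R)^nat) (l : \bar R) N :
  (forall n, (N <= n)%N -> u n <= l)%E -> (limn_esup u <= l)%E.
Proof.
move=> ul; rewrite limn_esup_lim; apply: lime_le; first exact: is_cvg_esups.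
exists N => // n /= Nn; apply: ge_ereal_sup => _ [k /= nk <-].
exact: ul (leq_trans Nn nk).
Qed.

Lemma limn_einf_ge_eventually (u : (\bar R)^nat) (l : \bar R) N :
  (forall n, (N <= n)%N -> l <= u n)%E -> (l <= limn_einf u)%E.
Proof.
move=> ul; rewrite limn_einf_lim; apply: lime_ge; first exact: is_cvg_einfs.
exists N => // n /= Nn; apply: le_ereal_inf_tmp => _ [k /= nk <-].
exact: ul (leq_trans Nn nk).
Qed.

End limits.

Section two_point_risk.
Context {R : realType} (f v : decreasing_density R) (n : nat) (eps : R).
Context (fv : indistinguishable f v n eps).

(** Under [f] the estimator is within [c] of [f 0], hence within
    [c + `|v 0 - f 0|] of [v 0], off the event [E], which has almost the same
    probability under both laws. *)
Lemma grenander_risk (alpha c : R) (E : set (n.-tuple R)) : measurable E ->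
  (iid_law (density_law f) n E <= alpha%:E)%E ->
  (forall X, ~ E X -> `|grenander X 0 - f 0| < c) ->
  (maxe (tail_prob f (fun X : n.-tuple R => grenander X 0%R) (c + `|v 0 - f 0|)%R)
        (tail_prob v (fun X : n.-tuple R => grenander X 0%R) (c + `|v 0 - f 0|)%R)
    <= (alpha + eps)%:E)%E.
Proof.
move=> mE PE EP.
have eps0 : (0 <= eps%:E)%E.
  have [_] := fv measurableT; rewrite !probability_setT.
  by rewrite -EFinD !lee_fin; lra.
rewrite ge_max; apply/andP; split.
  apply: (@le_trans _ _ (iid_law (density_law f) n E)); last first.
    by apply: (le_trans PE); rewrite EFinD leeDl.
  apply: iid_law_mono => X /=; apply: contraPP => /EP H; apply/negP.
  by rewrite -ltNge (lt_le_trans H)// lerDl.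
apply: (@le_trans _ _ (iid_law (density_law v) n E)); last first.
  by have [_ /le_trans] := fv mE; apply; rewrite EFinD leeD2r.
apply: iid_law_mono => X /=; apply: contraPP => /EP H; apply/negP.
rewrite -ltNge; apply: le_lt_trans (ler_distD (f 0) _ _) _.
by rewrite (distrC (f 0) (v 0)) ltrD2r.
Qed.

(** An estimator cannot be closer than [c] to both values, so the two error events
    cover the whole space; as [v] and [f] give nearly the same probabilities, their
    errors add up to at least 1 - eps. *)
Lemma le_cam_two_points (theta : n.-tuple R -> R) (c : R) :
  measurable_fun setT theta -> 2 * c <= `|v 0 - f 0| ->
  (((1 - eps) / 2)%:E <= maxe (tail_prob f theta c) (tail_prob v theta c))%E.
Proof.
move=> mtheta sep.
have mtail t : measurable [set X | c <= `|theta X - t|].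
  have mabs : measurable_fun setT (fun X => `|theta X - t|).
    by apply: measurableT_comp => //; exact: measurable_funB.
  rewrite [X in measurable X](_ : _ = (fun X => `|theta X - t|) @^-1` `[c, +oo[%classic).
    by rewrite -[X in measurable X]setTI; apply: mabs => //; exact: measurable_itv.
  by apply/seteqP; split => X /=; rewrite in_itv/= andbT.
have sub : (iid_law (density_law f) n (~` [set X | (c <= `|theta X - v 0|)%R]) <=
    tail_prob f theta c)%E.
  apply: iid_law_mono => X /= /negP; rewrite -ltNge => H.
  by have := ler_distD (theta X) (v 0) (f 0); rewrite (distrC (v 0) (theta X)); lra.
have [_ vf] := fv (measurableC (mtail (v 0))).
have {sub vf} : (1 <= tail_prob f theta c + eps%:E + tail_prob v theta c)%E.
  rewrite -leeBlDr; last exact: (fin_num_measure _ _ (mtail (v 0))).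
  rewrite -probability_setC; last exact: mtail.
  by apply: (le_trans vf); rewrite leeD2r.
rewrite /tail_prob -(fineK (fin_num_measure (iid_law (density_law f) n) _ (mtail (f 0)))).
rewrite -(fineK (fin_num_measure (iid_law (density_law v) n) _ (mtail (v 0)))).
move: (fine _) (fine _) => p q; rewrite le_max -!EFinD !lee_fin => H.
by have [//|H1] := leP ((1 - eps) / 2) p; lra.
Qed.

End two_point_risk.

Theorem theorem6p2 (R : realType) (f0 : decreasing_density R)
    (f0_cont : {for 0, continuous (f0 : R -> R)})
    (alpha beta : R) (alpha01 : 0 < alpha < 1) (beta012 : 0 < beta < 2^-1) :
  exists2 eta : R, 0 < eta &
  exists (f1 : nat -> decreasing_density R) (gamma : nat -> R),
    [/\ \forall n \near \oo, 0 < gamma n,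
        (limn_esup (fun n =>
            maxe (tail_prob f0 (fun X : n.-tuple R => grenander X 0) (gamma n))
                 (tail_prob (f1 n) (fun X : n.-tuple R => grenander X 0) (gamma n)))
          <= alpha%:E)%E &
        (limn_einf (fun n =>
            ereal_inf [set maxe (tail_prob f0 theta (eta * gamma n)%R)
                                (tail_prob (f1 n) theta (eta * gamma n)%R)
                      | theta in [set theta : n.-tuple R -> R |
                                  measurable_fun setT theta]])
          > beta%:E)%E].
Proof.
have /andP[al0 al1] := alpha01; have /andP[be0 be1] := beta012.
(* one half of alpha is spent on the risk under f0, the other on its transfer
   to f1, and (1 - eps) / 2 > beta *)
pose eps := Num.min (alpha / 2) (2^-1 - beta).
have e0 : 0 < eps by rewrite lt_min; apply/andP; split; lra.
have eal : eps <= alpha / 2 by rewrite ge_min lexx.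
have ebe : eps <= 2^-1 - beta by rewrite ge_min lexx orbT.
have eps01 : 0 < eps <= 1 by rewrite e0/=; lra.
have al20 : 0 < alpha / 2 by rewrite divr_gt0.
have [C [kap [C0 kap0 rate]]] := matched_rate_exists f0_cont al20 eps01.
have /choice[g gP] : forall n, exists p : R * decreasing_density R, (0 < n)%N ->
  [/\ 0 < p.1, exists E : set (n.-tuple R), [/\ measurable E,
      (iid_law (density_law f0) n E <= (alpha / 2)%:E)%E &
      forall X, ~ E X -> `|grenander X 0 - f0 0| < C * p.1],
    kap * p.1 <= `|p.2 0 - f0 0| & indistinguishable f0 p.2 n eps].
  case=> [|n]; first by exists (0, f0).
  by have [r [v rv]] := rate n.+1 isT; exists (r, v).
pose sep n := `|(g n).2 0 - f0 0|.
pose gamma n := C * (g n).1 + sep n.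
have sep0 n : (0 < n)%N -> 0 < sep n.
  move=> /gP[g0 _ gsep _]; apply: lt_le_trans gsep; exact: mulr_gt0.
exists (2 * (C / kap + 1))^-1; first by rewrite invr_gt0 mulr_gt0// addr_gt0// divr_gt0.
exists (fun n => (g n).2), gamma; split.
- exists 1%N => // n /= n0; have [g0 _ _ _] := gP n n0.
  by rewrite addr_gt0 ?sep0// mulr_gt0.
- apply: (@limn_esup_le_eventually _ _ _ 1) => n n0.
  have [_ [E [mE PE EP]] _ ind] := gP n n0.
  apply: le_trans (grenander_risk ind mE PE EP) _.
  by rewrite lee_fin; lra.
- apply: (@lt_le_trans _ _ ((1 - eps) / 2)%:E); first by rewrite lte_fin; lra.
  apply: (@limn_einf_ge_eventually _ _ _ 1) => n n0.
  have [g0 _ gsep ind] := gP n n0.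
  apply: le_ereal_inf_tmp => _ [theta mtheta <-].
  apply: le_cam_two_points => //.
  have D0 : 0 < C / kap + 1 by rewrite addr_gt0// divr_gt0.
  rewrite invfM -!mulrA mulVKf// mulrC ler_pdivrMr// mulrDr mulr1 lerD2r.
  by rewrite mulrCA ler_pM2l// ler_pdivlMr// mulrC.
Qed.
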